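(* There exists an LCL problem $\Pi$ (on graphs of bounded maximum degree) that can be solved by a deterministic LOCAL algorithm in $O(\log n)$ rounds, but for which every CONGEST algorithm, even randomized, requires $\Omega(\sqrt{n} / \log^2 n)$ rounds.
   Context: An LCL (locally checkable labeling) problem is a tuple $\Pi=(\Sigma_{\mathrm{in}},\Sigma_{\mathrm{out}},C,r)$ where $\Sigma_{\mathrm{in}},\Sigma_{\mathrm{out}}$ are finite label sets, $r$ is a constant (checkability radius), and $C$ is a finite set of pairs $(H,v)$ where $H$ is a graph, $v$ a node of $H$ of radius at most $r$ in $H$, and every node-edge pair (half-edge) of $H$ carries a label from $\Sigma_{\mathrm{in}}$ and one from $\Sigma_{\mathrm{out}}$; input graphs have maximum degree bounded by a constant $\Delta$. Solving $\Pi$: for any input labeling of the half-edges, assign output labels so that the labeled radius-$r$ ball around every node is isomorphic to a labeled graph in $C$. LOCAL model: the connected $n$-node input graph is the network; synchronous rounds with arbitrarily large messages. CONGEST model: same with $O(\log n)$-bit messages. Deterministic algorithms have unique IDs of $O(\log n)$ bits; randomized algorithms are Monte Carlo and must succeed with high probability. *)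

(* Defs.v *)
From mathcomp Require Import all_boot.
Set Implicit Arguments. Unset Strict Implicit. Unset Printing Implicit Defensive.

Definition ballR (T : finType) (e : rel T) (k : nat) (v : T) : {set T} :=
  iter k (fun S => S :|: [set u | [exists w in S, e w u]]) [set v].

(** A centred graph H with a node ctr, whose half-edges (x,y) (for e x y)
    carry an input label and an output label. *)
Record CLG (Sin Sout : finType) := MkCLG {
  clg_m : nat;
  clg_adj : rel 'I_clg_m;
  clg_ctr : 'I_clg_m;
  clg_in : 'I_clg_m -> 'I_clg_m -> Sin;
  clg_out : 'I_clg_m -> 'I_clg_m -> Sout }.
Arguments clg_m {Sin Sout} c.
Arguments clg_adj {Sin Sout} c _ _.
Arguments clg_ctr {Sin Sout} c.
Arguments clg_in {Sin Sout} c _ _.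
Arguments clg_out {Sin Sout} c _ _.

Definition clg_wf (Sin Sout : finType) (r : nat) (H : CLG Sin Sout) : bool :=
  [&& [forall x, ~~ clg_adj H x x],
      [forall x, forall y, clg_adj H x y == clg_adj H y x] &
      ballR (clg_adj H) r (clg_ctr H) == setT].

Record LCL := MkLCL {
  lcl_Delta : nat;
  lcl_Sin : finType;
  lcl_Sout : finType;
  lcl_r : nat;
  lcl_C : seq (CLG lcl_Sin lcl_Sout);
  lcl_wf : all (clg_wf lcl_r) lcl_C }.

Definition iso_ball (Sin Sout : finType) (n : nat) (adj : rel 'I_n)
    (inp : 'I_n -> 'I_n -> Sin) (out : 'I_n -> 'I_n -> Sout) (r : nat) (v : 'I_n)
    (H : CLG Sin Sout) : bool :=
  [exists f : {ffun 'I_(clg_m H) -> 'I_n},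
    [&& injectiveb f,
        [forall u, (u \in ballR adj r v) == [exists x, f x == u]],
        f (clg_ctr H) == v,
        [forall x, forall y, clg_adj H x y == adj (f x) (f y)] &
        [forall x, forall y, clg_adj H x y ==>
            ((clg_in H x y == inp (f x) (f y)) && (clg_out H x y == out (f x) (f y)))]]].

Definition valid_out (P : LCL) (n : nat) (adj : rel 'I_n)
    (inp : 'I_n -> 'I_n -> lcl_Sin P) (out : 'I_n -> 'I_n -> lcl_Sout P) : bool :=
  [forall v, has (iso_ball adj inp out (lcl_r P) v) (lcl_C P)].

Definition good_graph (Delta n : nat) (adj : rel 'I_n) : Prop :=
  [/\ 0 < n, irreflexive adj, symmetric adj, (forall u v, connect adj u v)
    & (forall v, #|[set u | adj v u]| <= Delta)].

Definition port_ok (Delta n : nat) (adj : rel 'I_n) (port : 'I_n -> 'I_n -> 'I_Delta) : Prop :=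
  forall v u w, adj v u -> adj v w -> port v u = port v w -> u = w.

(** Unique identifiers of O(log n) bits: injective, in [0, n^c). *)
Definition ids_ok (c n : nat) (id : 'I_n -> nat) : Prop :=
  injective id /\ forall v, id v < n ^ c.

(** A synchronous message-passing algorithm (family indexed by n, known to nodes).
    Node state St, message type Msg, rbits n random bits per node, rounds n rounds. *)
Record Algo (Delta : nat) (Sin Sout : Type) := MkAlgo {
  St : Type;
  Msg : Type;
  rbits : nat -> nat;
  rounds : nat -> nat;
  init : nat -> nat -> ('I_Delta -> option Sin) -> seq bool -> St;
  send : nat -> St -> 'I_Delta -> Msg;
  recv : nat -> St -> ('I_Delta -> option Msg) -> St;
  outp : nat -> St -> 'I_Delta -> Sout }.
Arguments St {Delta Sin Sout} a.
Arguments Msg {Delta Sin Sout} a.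
Arguments rbits {Delta Sin Sout} a _.
Arguments rounds {Delta Sin Sout} a _.
Arguments init {Delta Sin Sout} a _ _ _ _.
Arguments send {Delta Sin Sout} a _ _ _.
Arguments recv {Delta Sin Sout} a _ _ _.
Arguments outp {Delta Sin Sout} a _ _ _.

Definition port_nbr (Delta n : nat) (adj : rel 'I_n) (port : 'I_n -> 'I_n -> 'I_Delta)
    (v : 'I_n) (p : 'I_Delta) : option 'I_n :=
  [pick u | adj v u && (port v u == p)].

Fixpoint exec (Delta : nat) (Sin Sout : Type) (A : Algo Delta Sin Sout) (n : nat)
    (adj : rel 'I_n) (port : 'I_n -> 'I_n -> 'I_Delta) (id : 'I_n -> nat)
    (inp : 'I_n -> 'I_n -> Sin) (tape : 'I_n -> seq bool) (k : nat) : 'I_n -> St A :=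
  match k with
  | 0 => fun v => init A n (id v) (fun p => omap (inp v) (port_nbr adj port v p)) (tape v)
  | k'.+1 =>
      let s := @exec Delta Sin Sout A n adj port id inp tape k' in
      fun v => recv A n (s v)
        (fun p => omap (fun u => send A n (s u) (port u v)) (port_nbr adj port v p))
  end.

Definition out_lab (Delta : nat) (Sin Sout : Type) (A : Algo Delta Sin Sout) (n : nat)
    (adj : rel 'I_n) (port : 'I_n -> 'I_n -> 'I_Delta) (id : 'I_n -> nat)
    (inp : 'I_n -> 'I_n -> Sin) (tape : 'I_n -> seq bool) : 'I_n -> 'I_n -> Sout :=
  fun v u => outp A n (exec A adj port id inp tape (rounds A n) v) (port v u).

Definition AlgoFor (P : LCL) := Algo (lcl_Delta P) (lcl_Sin P) (lcl_Sout P).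

Definition det_solves (P : LCL) (c : nat) (A : AlgoFor P) : Prop :=
  (forall n, rbits A n = 0) /\
  forall n (adj : rel 'I_n) port id inp, good_graph (lcl_Delta P) adj ->
    port_ok adj port -> ids_ok c id ->
    forall t : {ffun 'I_n -> (rbits A n).-tuple bool},
      valid_out adj inp (out_lab A adj port id inp (fun v => t v)).

(** Monte Carlo algorithm: on every admissible n-node instance, succeeds with
    probability >= 1 - 1/n over independent uniform random bits at the nodes. *)
Definition rand_solves (P : LCL) (c : nat) (A : AlgoFor P) : Prop :=
  forall n (adj : rel 'I_n) port id inp, good_graph (lcl_Delta P) adj ->
    port_ok adj port -> ids_ok c id ->
    n.-1 * #|{ffun 'I_n -> (rbits A n).-tuple bool}| <=
    n * #|[set t : {ffun 'I_n -> (rbits A n).-tuple bool} |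
             valid_out adj inp (out_lab A adj port id inp (fun v => t v))]|.

Definition congest (Delta : nat) (Sin Sout : Type) (b : nat) (A : Algo Delta Sin Sout) : Prop :=
  exists enc : Msg A -> seq bool, injective enc /\
    forall n s p, size (enc (send A n s p)) <= b * (trunc_log 2 n).+1.

(* Main.v *)
(** The problem lives on a complete binary tree of depth [2 a] whose levels are
    paths.  The subtrees hanging at depth [a] are the [2 ^ a] columns, and the
    nodes at the same place of consecutive columns are linked into rows.  A node
    may either point to an error of this structure, through a pair of labels
    that propagate up to an ancestor and then down from it, or it must output the
    same bit as its row predecessor, the first node of a row outputting its input
    bit.

    A node without error below it has a complete subtree, so its height is at
    most [log n]; hence in O(log n) rounds of LOCAL every node sees an error or
    reads the bit of its row by walking up to the root and back down to the
    first column.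

    For the lower bound, the [2 ^ a] bits held by the leaves of the first column
    must be output by the leaves of the last one.  Let the set of nodes lying
    over a column with index larger than [t] shrink with the round number [t].
    A message enters it only from one of [a + 1] nodes per round, one on each
    level above the columns, so in [T < 2 ^ a - 1] rounds the last column
    receives O(T a log n) bits, which have to determine [2 ^ a] free bits. *)
From HB Require Import structures.
From Stdlib Require PeanoNat.
From Stdlib Require Import FunctionalExtensionality.
Require Import Defs.
From mathcomp Require Import all_boot zify.
Set Implicit Arguments. Unset Strict Implicit. Unset Printing Implicit Defensive.

(** * The labelling problem *)

(** Labels of the half-edges.  [Par i] points from an [i]-th child to its
    parent and [Chd i] from a parent to its [i]-th child (0 = [false], 1 =
    [true]); [Lft]/[Rgt] link neighbours on a level of the tree, [Prv]/[Nxt]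
    link the nodes of a row; half-edges labelled [Jnk _] are ignored. *)
Variant dir := Par of bool | Chd of bool | Lft | Rgt | Prv | Nxt | Jnk of bool.

Definition dir_code (d : dir) : bool * bool * bool * bool :=
  match d with
  | Par i => (true, true, true, i)
  | Chd i => (true, true, false, i)
  | Lft => (true, false, true, true)
  | Rgt => (true, false, true, false)
  | Prv => (true, false, false, true)
  | Nxt => (true, false, false, false)
  | Jnk i => (false, false, false, i)
  end.
Definition dir_decode (c : bool * bool * bool * bool) : option dir :=
  match c with
  | (true, true, true, i) => Some (Par i)
  | (true, true, false, i) => Some (Chd i)
  | (true, false, true, true) => Some Lft
  | (true, false, true, false) => Some Rgt
  | (true, false, false, true) => Some Prv
  | (true, false, false, false) => Some Nxt
  | (false, _, _, i) => Some (Jnk i)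
  end.
Lemma dir_codeK : pcancel dir_code dir_decode.
Proof. by case=> // -[]. Qed.
HB.instance Definition _ := Equality.copy dir (pcan_type dir_codeK).
HB.instance Definition _ := Choice.copy dir (pcan_type dir_codeK).
HB.instance Definition _ := Countable.copy dir (pcan_type dir_codeK).
HB.instance Definition _ := Finite.copy dir (pcan_type dir_codeK).

Definition opp (d : dir) : dir :=
  match d with
  | Par i => Chd i | Chd i => Par i
  | Lft => Rgt | Rgt => Lft
  | Prv => Nxt | Nxt => Prv
  | Jnk i => Jnk (~~ i)
  end.
Lemma oppK : involutive opp.
Proof. by case=> // -[]. Qed.

(** Labels that may not both occur at one node. *)
Definition samekey (d e : dir) : bool :=
  match d, e with Par _, Par _ => true | _, _ => d == e end.

(** Input: the direction, a mark "type A" and a data bit.  Output: "there is an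
    error below", "there is an error below some ancestor", and the row bit.  The
    last two inputs and all the outputs are properties of nodes, read off as
    "some half-edge carries it". *)
Notation Sin := (dir * bool * bool)%type.
Notation Sout := (bool * bool * bool)%type.

Section Structure.
Variables (n : nat) (adj : rel 'I_n) (inp : 'I_n -> 'I_n -> Sin).
Implicit Types u v : 'I_n.

Definition lab v u : dir := (inp v u).1.1.

Definition wf v : bool :=
  [forall u, forall w, adj v u ==> adj v w ==> samekey (lab v u) (lab v w) ==> (u == w)].

(** Edges whose two labels do not match are ignored, which makes [nb (opp d)]
    the partial inverse of [nb d] by definition. *)
Definition nb (d : dir) v : option 'I_n :=
  [pick u | [&& adj v u, wf v, wf u, lab v u == d & lab u v == opp d]].

Definition tyA v : bool := [exists u, adj v u && (inp v u).1.2].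
Definition bit v : bool := [exists u, adj v u && (inp v u).2].

Definition par v : option 'I_n :=
  if nb (Par false) v is Some u then Some u else nb (Par true) v.
(** On the levels of type A the row of a node is its whole level. *)
Definition prd v : option 'I_n := nb (if tyA v then Lft else Prv) v.
Definition kids v : bool * bool := (isSome (nb (Chd false) v), isSome (nb (Chd true) v)).

(** On levels of type A the predecessor of a right child is its left sibling, and that of a left
    child is the right child of the parent's predecessor. On other levels an [i]-th child follows
    the [i]-th child of the parent's predecessor. *)
Definition chd_ok v (i : bool) : bool :=
  if nb (Chd i) v is Some u then
    (tyA u ==> tyA v) &&
    (prd u == if tyA u && i then nb (Chd false) v
               else obind (nb (Chd (tyA u || i))) (prd v))
  else true.

(** The first four clauses make neighbouring error-free subtrees equally deep; the last three let
    the climbs from a node and from its row predecessor run in parallel. *)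
Definition valid v : bool :=
  [&& isSome (nb (Chd true) v) == isSome (nb (Chd false) v),
      obind (nb Rgt) (nb (Chd false) v) == nb (Chd true) v,
      obind (nb Rgt) (nb (Chd true) v) == obind (nb (Chd false)) (nb Rgt v),
      (if nb Rgt v is Some u then kids u == kids v else true),
      (if prd v is Some u then (kids u == kids v) && (tyA u == tyA v) else true),
      par v || ~~ prd v & chd_ok v false && chd_ok v true].

Variable out : 'I_n -> 'I_n -> Sout.

Definition outU v : bool := [exists u, adj v u && (out v u).1.1].
Definition outD v : bool := [exists u, adj v u && (out v u).1.2].
Definition outB v : bool := [exists u, adj v u && (out v u).2].

(** A claim must be passed on towards its reason: [outU] down to an invalid node, [outD] up to a
    node with [outU]. So a finite tree without errors admits no claim, and its row bits are
    forced. *)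
Definition chk v : bool :=
  [&& outU v ==> [|| ~~ valid v, oapp outU false (nb (Chd false) v)
                    | oapp outU false (nb (Chd true) v)],
      outD v ==> outU v || oapp outD false (par v)
    & ~~ outD v ==> (outB v == if prd v is Some u then outB u else bit v)].

End Structure.

Lemma ballRS (T : finType) (e : rel T) k (v w u : T) :
  w \in ballR e k v -> e w u -> u \in ballR e k.+1 v.
Proof.
move=> wb ewu; rewrite /= !inE; apply/orP; right; apply/existsP; exists w.
by rewrite wb.
Qed.

Lemma ballR_mono (T : finType) (e : rel T) k (v w : T) :
  w \in ballR e k v -> w \in ballR e k.+1 v.
Proof. by move=> wb; rewrite /= !inE wb. Qed.

Lemma nb_inP k (a : rel 'I_k) (i : 'I_k -> 'I_k -> Sin) d x y :
  nb a i d x = Some y -> [/\ a x y, wf a i x, wf a i y, lab i x y = d & lab i y x = opp d].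
Proof. by rewrite /nb; case: pickP => // z /and5P[? ? ? /eqP ? /eqP ?] [<-]. Qed.

Lemma wf_inj k (a : rel 'I_k) (i : 'I_k -> 'I_k -> Sin) x y z :
  wf a i x -> a x y -> a x z -> samekey (lab i x y) (lab i x z) -> y = z.
Proof.
by move=> /forallP/(_ y)/forallP/(_ z)/implyP W xy xz kk; have /implyP/(_ xz)/implyP/(_ kk)/eqP := W xy.
Qed.

Lemma samekey_refl d : samekey d d.
Proof. by case: d => //= *; exact: eqxx. Qed.

Lemma nb_SomeP k (a : rel 'I_k) (i : 'I_k -> 'I_k -> Sin) d x y :
  a x y -> wf a i x -> wf a i y -> lab i x y = d -> lab i y x = opp d -> nb a i d x = Some y.
Proof.
move=> xy wx wy lx ly; rewrite /nb; case: pickP => [z /and5P[xz _ _ /eqP lz _]|/(_ y)].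
  congr Some; apply: (wf_inj wx xz xy); rewrite lz lx; exact: samekey_refl.
by rewrite xy wx wy lx ly !eqxx.
Qed.

(** * Invariance of the checks under isomorphism of balls *)

Section Iso.
Variables (n m : nat) (adj : rel 'I_n) (inp : 'I_n -> 'I_n -> Sin) (out : 'I_n -> 'I_n -> Sout).
Variables (adjH : rel 'I_m) (inpH : 'I_m -> 'I_m -> Sin) (outH : 'I_m -> 'I_m -> Sout).
Variables (f : 'I_m -> 'I_n) (v : 'I_n).
Hypothesis adjC : symmetric adj.
Hypothesis f_inj : injective f.
Hypothesis f_ball : forall u, u \in ballR adj 3 v -> exists x, f x = u.
Hypothesis f_adj : forall x y, adjH x y = adj (f x) (f y).
Hypothesis f_lab : forall x y, adjH x y -> inpH x y = inp (f x) (f y) /\ outH x y = out (f x) (f y).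

Let B k x := f x \in ballR adj k v.

Let B_nbr x u : B 2 x -> adj (f x) u -> exists y, u = f y.
Proof.
move=> Bx xu; have [|y <-] := f_ball (u := u); last by exists y.
exact: ballRS Bx xu.
Qed.

Let exists_iso x (P : pred 'I_n) (Q : pred 'I_m) : B 2 x ->
  (forall y, adjH x y -> P (f y) = Q y) ->
  [exists u, adj (f x) u && P u] = [exists y, adjH x y && Q y].
Proof.
move=> Bx PQ; apply/existsP/existsP.
  case=> u /andP[xu Pu]; have [y Ey] := B_nbr Bx xu; subst u.
  by exists y; rewrite f_adj xu -PQ ?f_adj.
by case=> y /andP[xy Qy]; exists (f y); rewrite -f_adj xy PQ.
Qed.

Let tyA_iso x : B 2 x -> tyA adj inp (f x) = tyA adjH inpH x.
Proof. by move=> Bx; apply: exists_iso => // y /f_lab[->]. Qed.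
Let bit_iso x : B 2 x -> bit adj inp (f x) = bit adjH inpH x.
Proof. by move=> Bx; apply: exists_iso => // y /f_lab[->]. Qed.
Let outU_iso x : B 2 x -> outU adj out (f x) = outU adjH outH x.
Proof. by move=> Bx; apply: exists_iso => // y /f_lab[_ ->]. Qed.
Let outD_iso x : B 2 x -> outD adj out (f x) = outD adjH outH x.
Proof. by move=> Bx; apply: exists_iso => // y /f_lab[_ ->]. Qed.
Let outB_iso x : B 2 x -> outB adj out (f x) = outB adjH outH x.
Proof. by move=> Bx; apply: exists_iso => // y /f_lab[_ ->]. Qed.

Let wf_iso x : B 2 x -> wf adj inp (f x) = wf adjH inpH x.
Proof.
move=> Bx; apply/forallP/forallP => [W y|W u].
  apply/forallP => z; have /forallP/(_ (f z)) := W (f y).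
  rewrite -!f_adj /lab; case xy: (adjH x y) => //=; case xz: (adjH x z) => //=.
  have [-> _] := f_lab xy; have [-> _] := f_lab xz.
  by rewrite (inj_eq f_inj).
apply/forallP => w; apply/implyP => xu; apply/implyP => xw.
have [y Ey] := B_nbr Bx xu; have [z Ez] := B_nbr Bx xw; subst u w.
have /forallP/(_ z) := W y.
rewrite (inj_eq f_inj) f_adj xu f_adj xw /= /lab.
have [|-> _] := @f_lab x y; first by rewrite f_adj.
by have [|-> _] := @f_lab x z; first by rewrite f_adj.
Qed.

Let BS k x y : B k x -> adjH x y -> B k.+1 y.
Proof. by rewrite f_adj; apply: ballRS. Qed.

Let nb_iso d x : B 1 x -> nb adj inp d (f x) = omap f (nb adjH inpH d x).
Proof.
move=> Bx; case E: (nb adjH inpH d x) => [y|] /=.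
  have [xy wx wy lx ly] := nb_inP E; have By := BS Bx xy.
  have yx : adjH y x by rewrite f_adj adjC -f_adj.
  apply: nb_SomeP; rewrite -?f_adj ?wf_iso //; first exact: ballR_mono.
    by rewrite /lab -(f_lab xy).1.
  by rewrite /lab -(f_lab yx).1.
case E': (nb adj inp d (f x)) => [u|] //.
have [xu wx wu lx lu] := nb_inP E'.
have [y Ey] := B_nbr (ballR_mono Bx) xu; subst u.
have xy : adjH x y by rewrite f_adj.
have yx : adjH y x by rewrite f_adj adjC -f_adj.
have By := BS Bx xy.
rewrite (@nb_SomeP _ _ _ _ _ y) // in E.
- by rewrite -wf_iso //; apply: ballR_mono.
- by rewrite -wf_iso.
- by rewrite /lab (f_lab xy).1.
by rewrite /lab (f_lab yx).1.
Qed.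

Let nb_B d x y : B 0 x -> nb adjH inpH d x = Some y -> B 1 y.
Proof. by move=> Bx /nb_inP[xy _ _ _ _]; apply: BS xy. Qed.

Let omap_eq (o1 o2 : option 'I_m) : (omap f o1 == omap f o2) = (o1 == o2).
Proof. by case: o1 o2 => [x|] [y|] //=; rewrite !(inj_eq (@Some_inj _)) (inj_eq f_inj). Qed.

Let isSome_omap (o : option 'I_m) : isSome (omap f o) = isSome o.
Proof. by case: o. Qed.

Let obind_iso d (o : option 'I_m) : (forall y, o = Some y -> B 1 y) ->
  obind (nb adj inp d) (omap f o) = omap f (obind (nb adjH inpH d) o).
Proof. by case: o => //= y By; rewrite nb_iso //; apply: By. Qed.

Let kids_iso x : B 1 x -> kids adj inp (f x) = kids adjH inpH x.
Proof. by move=> Bx; rewrite /kids !nb_iso // !isSome_omap. Qed.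

Let prd_iso x : B 1 x -> prd adj inp (f x) = omap f (prd adjH inpH x).
Proof. by move=> Bx; rewrite /prd tyA_iso ?nb_iso //; apply: ballR_mono. Qed.

Let par_iso x : B 1 x -> par adj inp (f x) = omap f (par adjH inpH x).
Proof. by move=> Bx; rewrite /par !nb_iso //; case: (nb adjH _ _ _). Qed.

(** Radius 3 suffices: the half-edges at a node are all seen if it is within distance 2; [nb] also
    reads [wf] of the neighbour, so it needs distance 1; and [chk] composes at most two [nb] steps
    from the centre. *)
Lemma chk_iso x : f x = v -> chk adj inp out v = chk adjH inpH outH x.
Proof.
move=> Ex; rewrite -Ex.
have B0 : B 0 x by rewrite /B Ex /ballR /= inE.
have B1 : B 1 x := ballR_mono B0.
have B2 : B 2 x := ballR_mono B1.
have prd_B y : prd adjH inpH x = Some y -> B 1 y by apply: nb_B.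
have chd_ok_iso i : chd_ok adj inp (f x) i = chd_ok adjH inpH x i.
  rewrite /chd_ok !prd_iso // !nb_iso //.
  case E: (nb adjH inpH (Chd i) x) => [u|] //=.
  have Bu := nb_B B0 E; have Bu2 := ballR_mono Bu.
  by rewrite !tyA_iso // prd_iso // obind_iso // -(fun_if (omap f)) omap_eq.
have valid_iso : valid adj inp (f x) = valid adjH inpH x.
  rewrite /valid prd_iso // par_iso // !nb_iso // !isSome_omap !chd_ok_iso kids_iso //.
  rewrite !obind_iso ?omap_eq //; try by move=> y; apply: nb_B.
  congr [&& _, _, _, _, _ & _].
    by case E: (nb _ _ _ _) => [y|] //=; rewrite kids_iso //; apply: nb_B E.
  case E: (prd _ _ _) => [y|] //=; have By := prd_B _ E.
  by rewrite kids_iso // !tyA_iso //; apply: ballR_mono.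
rewrite /chk valid_iso outU_iso // outD_iso // outB_iso // bit_iso // prd_iso // par_iso // !nb_iso //.
have oapp_iso (P : pred 'I_n) (Q : pred 'I_m) o : (forall y, o = Some y -> P (f y) = Q y) ->
  oapp P false (omap f o) = oapp Q false o by case: o => //= y; apply.
congr [&& _, _ & _].
- congr (_ ==> [|| _, _ | _]); apply: oapp_iso => y /(nb_B B0) By; exact/outU_iso/ballR_mono.
- congr (_ ==> _ || _); apply: oapp_iso => y; rewrite /par.
  case E: nb => [z|]; last by move=> /(nb_B B0) By; exact/outD_iso/ballR_mono.
  by case=> <-; apply/outD_iso/ballR_mono/nb_B/E.
case E: (prd _ _ _) => [y|] //=; congr (_ ==> (_ == _)).
exact/outB_iso/ballR_mono/prd_B.
Qed.

End Iso.

(** * The problem as a finite list of labelled balls *)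

Definition Delta : nat := #|{: dir}|.

(** Labelled graphs as finite functions, so that [enum] can list them. *)
Definition clg_data (m : nat) : finType :=
  ({ffun 'I_m * 'I_m -> bool} * 'I_m * {ffun 'I_m * 'I_m -> Sin} * {ffun 'I_m * 'I_m -> Sout})%type.

Definition clg_of (m : nat) (x : clg_data m) : CLG Sin Sout :=
  @MkCLG Sin Sout m (fun i j => x.1.1.1 (i, j)) x.1.1.2
    (fun i j => x.1.2 (i, j)) (fun i j => x.2 (i, j)).

Definition chkH (H : CLG Sin Sout) : bool :=
  clg_wf 3 H && chk (clg_adj H) (clg_in H) (clg_out H) (clg_ctr H).

Definition all_clg (M : nat) : seq (CLG Sin Sout) :=
  flatten [seq [seq clg_of x | x <- enum (clg_data m)] | m <- iota 0 M].

(** The size bound comes from [card_ballR]: a ball of radius 3 has at most [Delta.+1 ^ 3] nodes. *)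
Definition treeC : seq (CLG Sin Sout) := [seq H <- all_clg (Delta.+1 ^ 3).+1 | chkH H].

Lemma treeC_wf : all (clg_wf 3) treeC.
Proof. by rewrite /treeC all_filter; elim: (all_clg _) => //= H s ->; rewrite andbT /chkH; case: clg_wf; rewrite ?implybT. Qed.

Definition treeLCL : LCL := @MkLCL Delta Sin Sout 3 treeC treeC_wf.

Lemma valid_out_chk n (adj : rel 'I_n) inp out v : symmetric adj ->
  @valid_out treeLCL n adj inp out -> chk adj inp out v.
Proof.
move=> adjC /forallP/(_ v) /=; rewrite /treeC; elim: (all_clg _) => //= H s IHs.
case: ifP => // cH; rewrite [has _ _]/= => /orP[|/IHs //].
case/existsP => f /and5P[/injectiveP f_inj /forallP f_ball /eqP f_ctr f_adj f_lab].
case/andP: cH => _; rewrite (@chk_iso n _ adj inp out (clg_adj H) (clg_in H) (clg_out H) f v adjC f_inj _ _ _ (clg_ctr H)) // => [u ub|x y|x y].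
- by have := f_ball u; rewrite ub => /esym/eqP/existsP[x /eqP <-]; exists x.
- by move: f_adj => /forallP/(_ x)/forallP/(_ y)/eqP.
by move: f_lab => /forallP/(_ x)/forallP/(_ y)/implyP fl /fl /andP[/eqP -> /eqP ->].
Qed.

Lemma card_ballR (T : finType) (e : rel T) D k v :
  symmetric e -> (forall u, #|[set w | e u w]| <= D) -> #|ballR e k v| <= D.+1 ^ k.
Proof.
move=> eC eD; elim: k => [|k IHk]; first by rewrite cards1.
rewrite /= -/(ballR e k v) expnS mulSn; apply: leq_trans (leq_card_setU _ _) _; apply: leq_add => //.
rewrite (_ : [set u | _] = \bigcup_(w in ballR e k v) [set u | e w u]); last first.
  apply/setP=> u; rewrite inE; apply/existsP/bigcupP.
    by case=> w /andP[wb ewu]; exists w; rewrite ?inE.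
  by case=> w wb; rewrite inE => ewu; exists w; rewrite wb.
apply: leq_trans (_ : \sum_(w in ballR e k v) #|[set u | e w u]| <= _).
  elim/big_rec2: _ => [|w y x _ le]; first by rewrite cards0.
  by rewrite (leq_trans (leq_card_setU _ _)) // leq_add2l.
apply: leq_trans (_ : \sum_(w in ballR e k v) D <= _); first by apply: leq_sum => w _; apply: eD.
by rewrite sum_nat_const mulnC leq_mul2l IHk orbT.
Qed.

(** The accepted graph matching the ball of [v] is that ball itself, renumbered by [enum_val]. *)
Lemma chk_valid_out n (adj : rel 'I_n) inp out :
  irreflexive adj -> symmetric adj -> (forall u, #|[set w | adj u w]| <= Delta) ->
  (forall v, chk adj inp out v) -> @valid_out treeLCL n adj inp out.
Proof.
move=> adjI adjC adjD chkG; apply/forallP => v /=.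
set B := ballR adj 3 v.
have vB : v \in B by rewrite /B; do 3!apply: ballR_mono; rewrite inE.
pose m := #|B|; pose f (x : 'I_m) : 'I_n := enum_val x.
pose c : 'I_m := enum_rank_in vB v.
have fc : f c = v by rewrite /f enum_rankK_in.
have f_inj : injective f by apply: enum_val_inj.
pose x : clg_data m :=
  ([ffun p => adj (f p.1) (f p.2)], c, [ffun p => inp (f p.1) (f p.2)], [ffun p => out (f p.1) (f p.2)]).
have f_ball u : u \in B -> exists y, f y = u.
  by move=> uB; exists (enum_rank_in vB u); rewrite /f enum_rankK_in.
have xadj i j : clg_adj (clg_of x) i j = adj (f i) (f j) by rewrite /= ffunE.
have xlab i j : clg_adj (clg_of x) i j -> clg_in (clg_of x) i j = inp (f i) (f j) /\ clg_out (clg_of x) i j = out (f i) (f j).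
  by rewrite /= !ffunE.
rewrite /treeC; have -> : has (iso_ball adj inp out 3 v) [seq H <- all_clg (Delta.+1 ^ 3).+1 | chkH H]
   = has (predI (iso_ball adj inp out 3 v) chkH) (all_clg (Delta.+1 ^ 3).+1).
  by elim: (all_clg _) => //= H s <-; case: (chkH H); rewrite ?andbT ?andbF.
rewrite /all_clg; have -> (T : Type) (a : pred T) (ss : seq (seq T)) : has a (flatten ss) = has (has a) ss.
  by elim: ss => //= s ss <-; rewrite has_cat.
rewrite has_map; apply/hasP; exists m.
  by rewrite mem_iota /= ltnS card_ballR.
rewrite /= has_map; apply/hasP; exists x; first by rewrite mem_enum.
apply/andP; split.
  apply/existsP; exists (finfun f); apply/and5P; split.
  - by apply/injectiveP => i j; rewrite !ffunE; apply: f_inj.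
  - apply/forallP => u; apply/eqP; apply/idP/existsP => [/f_ball[y <-]|[y]].
      by exists y; rewrite ffunE.
    by rewrite ffunE => /eqP <-; apply: enum_valP.
  - by rewrite ffunE fc.
  - by apply/forallP => i; apply/forallP => j; rewrite xadj !ffunE.
  - by apply/forallP => i; apply/forallP => j; apply/implyP => /xlab[-> ->]; rewrite !ffunE !eqxx.
apply/andP; split; last by rewrite -(@chk_iso n _ adj inp out _ _ _ f v adjC f_inj f_ball xadj xlab c fc).
apply/and3P; split.
- by apply/forallP => i; rewrite xadj adjI.
- by apply/forallP => i; apply/forallP => j; rewrite !xadj adjC.
have inH k i : k <= 3 -> f i \in ballR adj k v -> i \in ballR (clg_adj (clg_of x)) k c.
  elim: k i => [|k IHk] i k3; first by rewrite !inE -fc => /eqP/f_inj ->.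
  rewrite /= !inE -/(ballR adj k v) -/(ballR (clg_adj (clg_of x)) k c) => /orP[/IHk-> //|]; first exact: ltnW.
  case/existsP => w /andP[wb wi].
  have [|y Ey] := f_ball w; last subst w.
    have : w \in ballR adj k v by [].
    rewrite /B; move: k3; clear; case: k => [|[|[|k]]] // _ wk; by do ?[exact: wk | apply: ballR_mono].
  apply/orP; right; apply/existsP; exists y; rewrite IHk ?(ltnW k3) //.
  by rewrite ffunE.
apply/eqP/setP => i; rewrite [RHS]inE; apply: inH => //; exact: enum_valP.
Qed.

(** * Solving the problem *)

Section Labels.
Variables (n : nat) (adj : rel 'I_n) (inp : 'I_n -> 'I_n -> Sin).
Implicit Types u v p : 'I_n.
Local Notation nb := (nb adj inp).
Local Notation par := (par adj inp).
Local Notation prd := (prd adj inp).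
Local Notation tyA := (tyA adj inp).
Local Notation bit := (bit adj inp).
Local Notation valid := (valid adj inp).

(** The index of [v] as a child; it is meaningful only if [v] has a parent, and is [true] by default
    otherwise. *)
Definition side v : bool := ~~ nb (Par false) v.

Fixpoint err_below (k : nat) v : bool :=
  if k is k'.+1 then
    [|| ~~ valid v, oapp (err_below k') false (nb (Chd false) v)
      | oapp (err_below k') false (nb (Chd true) v)]
  else false.

Fixpoint err_above (K k : nat) v : bool :=
  if k is k'.+1 then err_below K v || oapp (err_above K k') false (par v) else false.

Fixpoint down (k : nat) v : seq bool -> bool := fun w =>
  match w, k with
  | [::], _ => bit v
  | i :: w', k'.+1 => oapp (fun u => down k' u w') false (nb (Chd i) v)
  | _, _ => false
  end.

(** Climb to the root while recording the way back down inside the column, with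
    the steps above the column head replaced by left turns; then go down. *)
Fixpoint row_bit (K k : nat) v : seq bool -> bool := fun w =>
  if k is k'.+1 then
    if par v is Some p then row_bit K k' p ((~~ tyA v && side v) :: w) else down K v w
  else false.

Hypothesis adjC : symmetric adj.

Lemma nb_opp d v u : nb d v = Some u -> nb (opp d) u = Some v.
Proof. by case/nb_inP => vu wv wu lv lu; apply: nb_SomeP; rewrite ?oppK // adjC. Qed.

Lemma par_chd v p : par v = Some p -> nb (Chd (side v)) p = Some v.
Proof.
rewrite /par /side; case E: (nb (Par false) v) => [q|] /= => [[<-]|] /=; first exact: nb_opp E.
by move/nb_opp.
Qed.

(** Since [samekey] identifies [Par false] with [Par true], a well-formed node has only one
    parent. *)
Lemma chd_par i v p : nb (Chd i) p = Some v -> par v = Some p /\ side v = i.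
Proof.
move/nb_opp; rewrite /= /par /side; case: i => [E|->] //.
case E0: (nb (Par false) v) => [q|] //.
have [vq wv _ lq _] := nb_inP E0; have [vp _ _ lp _] := nb_inP E.
have Epq : q = p by apply: (wf_inj wv vq vp); rewrite lq lp.
by move: lq lp; rewrite Epq => ->.
Qed.

Fixpoint anc_valid (k : nat) v : bool :=
  valid v && (if k is k'.+1 then oapp (anc_valid k') true (par v) else true).

Fixpoint root_within (k : nat) v : bool :=
  if k is k'.+1 then oapp (root_within k') true (par v) else false.

Lemma anc_valid0 k v : anc_valid k v -> valid v.
Proof. by case: k => [|k] /= /andP[]. Qed.

Lemma valid_prd v u : valid v -> prd v = Some u -> kids adj inp u = kids adj inp v /\ tyA u = tyA v.
Proof. by case/and5P=> _ _ _ _ /andP[+ _] => + E; rewrite E => /andP[/eqP-> /eqP->]. Qed.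

Lemma valid_root v : valid v -> par v = None -> prd v = None.
Proof. by case/and5P=> _ _ _ _ /and3P[_ + _] => + E; rewrite E; case: prd. Qed.

Lemma valid_chd p v : valid p -> par v = Some p ->
  (tyA v -> tyA p) /\
  prd v = if tyA v && side v then nb (Chd false) p else obind (nb (Chd (tyA v || side v))) (prd p).
Proof.
case/and5P=> _ _ _ _ /and3P[_ _ /andP[V0 V1]] /par_chd E.
have : chd_ok adj inp p (side v) by case: (side v).
by rewrite /chd_ok E => /andP[/implyP ? /eqP].
Qed.

(** Either [u] is the left sibling of [v] on a level of type A, and both climb to the same parent
    recording a left turn; or the two parents are again consecutive in a row and the recorded turns
    agree. *)
Lemma row_bit_prd K k v u w : anc_valid k v -> prd v = Some u ->
  row_bit K k v w = row_bit K k u w.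
Proof.
elim: k v u w => [//|k IHk] v u w /= /andP[vv] + Eu.
case Ep: (par v) => [p|] /=; last by rewrite valid_root in Eu.
move=> ap; have vp := anc_valid0 ap.
have [_ tu] := valid_prd vv Eu.
have [tp] := valid_chd vp Ep; rewrite Eu; case: ifP => [/andP[tv sv] /esym/chd_par[-> su]|].
  by rewrite tu tv.
move=> tsv; case Eq: (prd p) => [q|] //= /esym/chd_par[-> su].
rewrite (IHk p q) // tu su; case: (tyA v) tsv => //=.
Qed.

(** For the first node of a row the turns recorded on levels of type A really are left turns, so the
    recorded word leads from the root back to [v]. The size condition gives [down] enough fuel. *)
Lemma row_bit_first K k v w : anc_valid k v -> root_within k v -> prd v = None ->
  size w + k <= K.+1 -> row_bit K k v w = down K v w.
Proof.
have down_id s j j' u : size s <= j -> size s <= j' -> down j u s = down j' u s.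
  elim: s j j' u => [|i s IHw] [|j] [|j'] u //=; rewrite !ltnS => wj wj'.
  by case: (nb _ u) => //= z; apply: IHw.
elim: k v w => [//|k IHk] v w /= /andP[vv] + + Eu wK.
case Ep: (par v) => [p|] //= ap rp; have vp := anc_valid0 ap.
have [tp] := valid_chd vp Ep; rewrite Eu.
have Ev := par_chd Ep.
have [/eqP kp _ _ _ _] := and5P vp.
have kidp i : nb (Chd i) p.
  have : nb (Chd (side v)) p by rewrite Ev.
  by case: (side v) i => -[] //; rewrite ?kp // -kp.
case: ifP => [_|tsv]; first by have := kidp false; case: (nb _ p).
have -> : (~~ tyA v && side v) = side v by move: tsv; case: (tyA v); case: (side v).
(* The parent is first in its row as well: a predecessor [q] would have the same kids as [p], and
   one of them would precede [v]. *)
case Eq: (prd p) => [q|] /=.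
  have [[k1 k2] _] := valid_prd vp Eq; set i := _ || _ => En; exfalso.
  have : nb (Chd i) q by case: (i); rewrite ?k1 ?k2; apply: kidp.
  by rewrite -En.
move=> _; rewrite IHk //=; last by rewrite addSnnS.
have k0 : 0 < k by case: (k) rp.
have K0 : 0 < K by lia.
rewrite -[in LHS](prednK K0) /= Ev /=; apply: down_id; lia.
Qed.

(** * Error-free subtrees are complete *)

Fixpoint has_desc (k : nat) v : bool :=
  if k is k'.+1 then oapp (has_desc k') false (nb (Chd false) v) || oapp (has_desc k') false (nb (Chd true) v)
  else true.

Fixpoint full_desc (k : nat) v : bool :=
  if k is k'.+1 then oapp (full_desc k') false (nb (Chd false) v) && oapp (full_desc k') false (nb (Chd true) v)
  else true.

(** The level links force error-free subtrees next to each other to have the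
    same depth, so that an error-free subtree is complete. *)
Lemma full_desc_rgt k u v : ~~ err_below k u -> ~~ err_below k v -> nb Rgt u = Some v ->
  [/\ full_desc k u = full_desc k v, has_desc k u = full_desc k u & has_desc k v = full_desc k v].
Proof.
elim: k u v => [//|k IHk] u v /=; rewrite !negb_or !negbK.
case/and3P=> /and5P[/eqP u1 /eqP u2 /eqP u3 u4 _] u5 u6 /and3P[/and5P[/eqP v1 /eqP v2 _ _ _] v5 v6] Euv.
move: u4 u3; rewrite Euv => /eqP[k1 k2] /=.
case E0: (nb (Chd false) u) u1 u2 u5 k1 => [c0|]; case E1: (nb (Chd true) u) u6 k2 => [c1|] //=; last first.
  by move=> _ /esym; case: (nb (Chd true) v) => // _ _ _ _ /esym; case: (nb (Chd false) v).
case E2: (nb (Chd false) v) v1 v2 v5 => [d0|]; case E3: (nb (Chd true) v) v6 => [d1|] //=.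
move=> e3 _ r2 e2 e1 _ _ r0 e0 _ r1.
have [f1 h1 _] := IHk _ _ e0 e1 r0.
have [f2 h2 _] := IHk _ _ e1 e2 r1.
have [f3 h3 h4] := IHk _ _ e2 e3 r2.
by rewrite h1 h2 h3 h4 f1 f2 f3 andbb orbb.
Qed.

Lemma has_desc_full k v : ~~ err_below k v -> has_desc k v -> full_desc k v.
Proof.
case: k => [//|k] /=; rewrite !negb_or !negbK => /and3P[/and5P[/eqP v1 /eqP v2 _ _ _]].
case E0: (nb (Chd false) v) v1 v2 => [c0|]; case E1: (nb (Chd true) v) => [c1|] //= _ r e0 e1.
by have [f h1 h2] := full_desc_rgt e0 e1 r; rewrite h1 h2 f orbb andbb.
Qed.

(** In contrast to [down], the head of the word is the last step, so that injectivity follows by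
    peeling off parents. *)
Fixpoint desc (w : seq bool) v : option 'I_n :=
  if w is i :: w' then obind (nb (Chd i)) (desc w' v) else Some v.

Lemma desc_rcons w i v : desc (rcons w i) v = obind (desc w) (nb (Chd i) v).
Proof. by elim: w => [|j w IHw] /=; rewrite ?IHw; case: (nb _ v). Qed.

Lemma full_desc_card k v : full_desc k v -> 2 ^ k <= n.
Proof.
move=> fv; have dP w u : size w = k -> full_desc k u -> desc w u.
  elim/last_ind: w k {fv} u => [|w i IHw] [|k] u //=; rewrite ?size_rcons // desc_rcons => -[sw].
  by case: i; [case/andP=> _|case/andP=> + _]; case: (nb _ u) => //= z; apply: IHw.
have inj (w w' : k.-tuple bool) : desc w v = desc w' v -> w = w'.
  have dI s s' u : size s = size s' -> desc s v = Some u -> desc s' v = Some u -> s = s'.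
    elim: s s' u => [|i s IHs] [|j s'] u //= [ss].
    case Es: (desc s v) => [z|] //= Ez; case Es': (desc s' v) => [z'|] //= Ez'.
    have [Ep <-] := chd_par Ez; have [] := chd_par Ez'; rewrite Ep => -[Ezz] <-.
    by congr (_ :: _); apply: (IHs s' z) => //; rewrite Es' Ezz.
  move=> Eww; apply: val_inj; have := dP w v (size_tuple w) fv.
  case Ew: (desc w v) => [u|] // _; apply: (dI _ _ u) => //; last by rewrite -Eww.
  by rewrite !size_tuple.
have : injective (fun w : k.-tuple bool => odflt v (desc w v)).
  move=> w w' /=; have := dP w v (size_tuple w) fv; have := dP w' v (size_tuple w') fv.
  case E: (desc w v) => [u|] //; case E': (desc w' v) => [u'|] // _ _ /= Eu.
  by apply: inj; rewrite E E' Eu.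
by move/leq_card; rewrite card_tuple card_bool card_ord.
Qed.

Lemma err_below_mono k v : err_below k v -> err_below k.+1 v.
Proof.
elim: k v => [//|k IHk] v /=; case/or3P=> [->//|e|e]; apply/or3P; [constructor 2|constructor 3].
  by case: (nb _ v) e => //= u /IHk.
by case: (nb _ v) e => //= u /IHk.
Qed.

Lemma err_below_le j k v : j <= k -> err_below j v -> err_below k v.
Proof.
move=> /subnK <-; elim: (k - j) => [//|m IHm] /IHm; rewrite addSn; exact: err_below_mono.
Qed.

Lemma err_above_mono K k v : err_above K k v -> err_above K k.+1 v.
Proof.
elim: k v => [//|k IHk] v /= /orP[->//|e]; apply/orP; right.
by case: (par v) e => //= u /IHk.
Qed.

Lemma err_above_le K j k v : j <= k -> err_above K j v -> err_above K k v.
Proof.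
move=> /subnK <-; elim: (k - j) => [//|m IHm] /IHm; rewrite addSn; exact: err_above_mono.
Qed.

(** An ancestor at distance [L] without error below would have [2 ^ L]
    descendants. *)
Lemma no_err_root K L v : L < K -> n < 2 ^ L -> ~~ err_above K L.+1 v -> root_within L v.
Proof.
move=> LK Ln eL; apply: contraT => rL.
suff [p [j [Lj jK ep dp]]] : exists p j, [/\ L <= j, j <= K, ~~ err_below K p & has_desc j p].
  have fp : full_desc j p by apply: has_desc_full => //; apply: contra ep; apply: err_below_le.
  by have := full_desc_card fp; rewrite leqNgt (leq_trans Ln) // leq_exp2l.
suff gen k j u : ~~ err_above K k.+1 u -> ~~ root_within k u -> has_desc j u ->
   exists p, ~~ err_below K p /\ has_desc (j + k) p.
  have [p [ep dp]] := gen L 0 v eL rL isT; exists p, L; split=> //; exact: ltnW.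
elim: k j u => [|k IHk] j u; first by rewrite /= negb_or addn0 => /andP[eu _] _ dj; exists u.
rewrite [err_above _ _ _]/= negb_or => /andP[_] /=.
case Ep: (par u) => [p|] //= ep rp dj; rewrite addnS -addSn; apply: (IHk _ p) => //.
by have := par_chd Ep; case: (side u) => E /=; rewrite E /= dj ?orbT.
Qed.

Lemma no_err_anc K k v : 0 < K -> ~~ err_above K k.+1 v -> anc_valid k v.
Proof.
case: K => // K _; elim: k v => [|k IHk] v.
  by rewrite /= !negb_or negbK => /andP[/and3P[-> _ _]].
rewrite [err_above _ _ _]/= negb_or => /andP[e1 e2] /=.
move: e1; rewrite /= !negb_or negbK => /and3P[-> _ _] /=.
by case: (par v) e2 => //= p; apply: IHk.
Qed.

(** An error found with fuel [K] is passed on with fuel [K.-1], hence also with fuel [K] by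
    monotonicity. A node that claims nothing has only valid ancestors within [L] steps and reaches
    the root there, so its row bit is correct. *)
Lemma labels_chk K L out : L < K -> n < 2 ^ L ->
  (forall v u, adj v u -> out v u = (err_below K v, err_above K K v, row_bit K L v [::])) ->
  forall v, chk adj inp out v.
Proof.
move=> LK Ln outE v.
have rdE (P : pred Sout) x : [exists u, adj x u && P (out x u)] =
    [exists u, adj x u] && P (err_below K x, err_above K K x, row_bit K L x [::]).
  apply/existsP/andP => [[u /andP[xu]]|[/existsP[u xu] Pu]].
    by rewrite outE // => ->; split=> //; apply/existsP; exists u.
  by exists u; rewrite xu outE.
have outUE x : outU adj out x = [exists u, adj x u] && err_below K x by exact: (rdE (fun o => o.1.1)).
have outDE x : outD adj out x = [exists u, adj x u] && err_above K K x by exact: (rdE (fun o => o.1.2)).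
have outBE x : outB adj out x = [exists u, adj x u] && row_bit K L x [::] by exact: (rdE (fun o => o.2)).
have nb_deg d u w : nb d u = Some w -> [exists z, adj u z] /\ [exists z, adj w z].
  by case/nb_inP=> uw _ _ _ _; split; apply/existsP; [exists w|exists u; rewrite adjC].
(* A node without neighbours has no half-edge to carry a label; all its outputs and its input bit
   read [false]. *)
rewrite /chk !outUE !outDE !outBE; case: (boolP [exists u, adj v u]) => [vdeg|vdeg] /=; last first.
  rewrite /prd; case E: (nb _ _) => [u|]; first by have [dv _] := nb_deg _ _ _ E; rewrite dv in vdeg.
  by rewrite eq_sym eqbF_neg; apply: contra vdeg => /existsP[u /andP[vu _]]; apply/existsP; exists u.
have K0 : 0 < K by apply: leq_ltn_trans LK.
apply/and3P; split.
- apply/implyP => eb; have {eb} : err_below K.-1.+1 v by rewrite prednK.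
  move=> /= /or3P[->//|e|e]; apply/or3P; [constructor 2|constructor 3];
  case E: (nb _ v) e => [u|] //= /err_below_mono; rewrite prednK // outUE => ->;
  by have [_ ->] := nb_deg _ _ _ E.
- apply/implyP => ea; have {ea} : err_above K K.-1.+1 v by rewrite prednK.
  move=> /= /orP[->//|e]; apply/orP; right.
  case E: (par v) e => [u|] //= /err_above_mono; rewrite prednK // outDE => ->.
  by have [-> _] := nb_deg _ _ _ (par_chd E).
apply/implyP => eK.
have eL : ~~ err_above K L.+1 v by apply: contra eK; apply: err_above_le.
have aL := no_err_anc K0 eL.
case Eu: (prd v) => [u|].
  have [_ du] := nb_deg _ _ _ Eu.
  by rewrite outBE du (row_bit_prd K [::] aL Eu).
rewrite (row_bit_first aL (no_err_root LK Ln eL) Eu); first by case: (K).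
by rewrite add0n; apply/ltnW/leqW.
Qed.
End Labels.

(** * Locality *)

Inductive view : Type :=
  | ViewInit of nat & ('I_Delta -> option Sin)
  | ViewStep of view & ('I_Delta -> option ('I_Delta * view)).

(** The full-information protocol: every node sends all it knows, together with the port used, and
    only the final decoding [g] is specific to the problem. *)
Definition view_algo (R : nat -> nat) (g : nat -> view -> Sout) : Algo Delta Sin Sout :=
  @MkAlgo Delta Sin Sout view ('I_Delta * view)%type (fun _ => 0) R
    (fun _ id ins _ => ViewInit id ins) (fun _ s p => (p, s)) (fun _ => ViewStep)
    (fun n s _ => g n s).

Record inst (n : nat) := Inst {
  iadj : rel 'I_n;
  iport : 'I_n -> 'I_n -> 'I_Delta;
  iid : 'I_n -> nat;
  iinp : 'I_n -> 'I_n -> Sin;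
  iadjC : symmetric iadj;
  iportP : port_ok iadj iport;
  iid_inj : injective iid }.

Section Local.
Variable n : nat.
Implicit Types (I : inst n) (v u : 'I_n).

Definition pnbr I v p := port_nbr (iadj I) (iport I) v p.

Fixpoint uview I (k : nat) : 'I_n -> view :=
  match k with
  | 0 => fun v => ViewInit (iid I v) (fun p => omap (iinp I v) (pnbr I v p))
  | k'.+1 => fun v => ViewStep (uview I k' v)
      (fun p => omap (fun u => (iport I u v, uview I k' u)) (pnbr I v p))
  end.

Lemma exec_uview I R g tape k :
  exec (view_algo R g) (iadj I) (iport I) (iid I) (iinp I) tape k = uview I k.
Proof. by elim: k => //= k ->. Qed.

Lemma pnbrP I v p u : pnbr I v p = Some u <-> iadj I v u /\ iport I v u = p.
Proof.
rewrite /pnbr /port_nbr; split.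
  by case: pickP => // w /andP[vw /eqP <-] [<-].
case=> vu pvu; case: pickP => [w /andP[vw /eqP pvw]|/(_ u)].
  by congr Some; apply: (iportP vw vu); rewrite pvw.
by rewrite vu pvu eqxx.
Qed.

Lemma pnbr_port I v u : iadj I v u -> pnbr I v (iport I v u) = Some u.
Proof. by move=> vu; apply/pnbrP. Qed.

(** [f] is computable in [t] rounds.  The decoder is kept in [Type], so that one
    can be picked for every [n] without a choice axiom. *)
Definition loc (t : nat) (X : Type) (f : inst n -> 'I_n -> X) : Type :=
  {g : view -> X | forall I v, f I v = g (uview I t v)}.

Lemma loc_ext t X (f h : inst n -> 'I_n -> X) : (forall I v, f I v = h I v) -> loc t f -> loc t h.
Proof. by move=> E [g fg]; exists g => I v; rewrite -E. Qed.

Lemma loc_const t X (x : X) : loc t (fun _ _ => x).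
Proof. by exists (fun _ => x). Qed.

Lemma loc_app t X Y (f : inst n -> 'I_n -> X -> Y) (h : inst n -> 'I_n -> X) :
  loc t f -> loc t h -> loc t (fun I v => f I v (h I v)).
Proof. by move=> [g fg] [g' hg]; exists (fun s => g s (g' s)) => I v; rewrite fg hg. Qed.

Lemma loc_map t X Y (F : X -> Y) (f : inst n -> 'I_n -> X) :
  loc t f -> loc t (fun I v => F (f I v)).
Proof. by move=> lf; apply: (loc_app (f := fun _ _ => F)) => //; apply: loc_const. Qed.

Lemma loc_map2 t X Y Z (F : X -> Y -> Z) (f : inst n -> 'I_n -> X) (h : inst n -> 'I_n -> Y) :
  loc t f -> loc t h -> loc t (fun I v => F (f I v) (h I v)).
Proof. by move=> lf lh; apply: (loc_app (f := fun I v => F (f I v))) => //; apply: loc_map. Qed.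

Lemma loc_if t X (b : inst n -> 'I_n -> bool) (f h : inst n -> 'I_n -> X) :
  loc t b -> loc t f -> loc t h -> loc t (fun I v => if b I v then f I v else h I v).
Proof.
by move=> [gb bE] [gf fE] [gh hE]; exists (fun s => if gb s then gf s else gh s) => I v; rewrite bE fE hE.
Qed.

Lemma loc_le t t' X (f : inst n -> 'I_n -> X) : t <= t' -> loc t f -> loc t' f.
Proof.
move=> /subnK <-; elim: (t' - t) => [//|m IHm] /IHm[g fg].
by exists (fun s => if s is ViewStep s' _ then g s' else g s) => I v; rewrite fg addSn.
Qed.

Lemma loc_id t : loc t (@iid n).
Proof.
by apply: (@loc_le 0) => //; exists (fun s => if s is ViewInit i _ then i else 0) => I v.
Qed.

Definition tab I v : {ffun 'I_Delta -> option Sin} := [ffun p => omap (iinp I v) (pnbr I v p)].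

Lemma tab_port I v u : iadj I v u -> tab I v (iport I v u) = Some (iinp I v u).
Proof. by move=> vu; rewrite ffunE pnbr_port. Qed.

Lemma loc_tab t : loc t tab.
Proof.
apply: (@loc_le 0) => //.
exists (fun s => [ffun p => if s is ViewInit _ ins then ins p else None]) => I v.
by apply/ffunP=> p; rewrite !ffunE.
Qed.

Lemma loc_msgs t X (f : inst n -> 'I_n -> X) : loc t f ->
  loc t.+1 (fun I v => [ffun p => omap (fun u => (iport I u v, f I u)) (pnbr I v p)]).
Proof.
move=> [g fg]; exists (fun s => [ffun p => if s is ViewStep _ m then omap (fun x => (x.1, g x.2)) (m p) else None]).
move=> I v; apply/ffunP=> p; rewrite !ffunE /=.
by case: (pnbr I v p) => //= u; rewrite fg.
Qed.

Definition wf_tab (s : {ffun 'I_Delta -> option Sin}) : bool :=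
  [forall p, forall q, if s p is Some x then if s q is Some y then
     samekey x.1.1 y.1.1 ==> (p == q) else true else true].

Lemma wf_tabE I v : wf_tab (tab I v) = wf (iadj I) (iinp I) v.
Proof.
apply/forallP/forallP => [W u|W p].
  apply/forallP => w; apply/implyP => vu; apply/implyP => vw; apply/implyP => k.
  have /forallP/(_ (iport I v w)) := W (iport I v u).
  by rewrite !tab_port // => /implyP/(_ k)/eqP/(iportP vu vw) ->.
apply/forallP => q; rewrite !ffunE.
case Ep: (pnbr I v p) => [u|] //=; case Eq: (pnbr I v q) => [w|] //=.
have [vu <-] := iffLR (pnbrP _ _ _ _) Ep; have [vw <-] := iffLR (pnbrP _ _ _ _) Eq.
have /forallP/(_ w) := W u; rewrite vu vw /= => /implyP k; apply/implyP => /k/eqP ->.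
exact: eqxx.
Qed.

Notation inb d I v := (nb (iadj I) (iinp I) d v).
Notation iprd I v := (prd (iadj I) (iinp I) v).
Notation ipar I v := (par (iadj I) (iinp I) v).

Definition port_dir X (d : dir) (s : {ffun 'I_Delta -> option Sin})
    (m : {ffun 'I_Delta -> option ('I_Delta * ({ffun 'I_Delta -> option Sin} * X))}) p : bool :=
  if s p is Some x then if m p is Some (q, (s', _)) then
    if s' q is Some y then [&& wf_tab s, wf_tab s', x.1.1 == d & y.1.1 == opp d] else false
  else false else false.

(** One round is enough, because the neighbour sends its port and its whole table along with the
    value of [f]; this reveals the opposite label of the edge and whether the neighbour is
    well-formed. *)
Lemma loc_nb d t X (f : inst n -> 'I_n -> X) : loc t f ->
  loc t.+1 (fun I v => omap (f I) (inb d I v)).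
Proof.
move=> lf; pose F s m := if [pick p | @port_dir X d s m p] is Some p
   then omap (fun x => x.2.2) (m p) else None.
apply: (loc_ext (f := fun I v => F (tab I v)
   [ffun p => omap (fun u => (iport I u v, (tab I u, f I u))) (pnbr I v p)])); last first.
  apply: loc_map2; first exact: loc_tab.
  apply: (loc_msgs (f := fun I u => (tab I u, f I u))); apply: loc_map2 => //; exact: loc_tab.
move=> I v; rewrite /F; set m := [ffun p => _].
have pdP p : port_dir d (tab I v) m p -> exists2 u, inb d I v = Some u & pnbr I v p = Some u.
  rewrite /port_dir /m !ffunE; case Ep: (pnbr I v p) => [u|] //=.
  have [vu _] := iffLR (pnbrP _ _ _ _) Ep.
  have uv : iadj I u v by rewrite iadjC.
  rewrite (tab_port uv) => /and4P[wv wu /eqP lv /eqP lu]; exists u => //.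
  by apply: nb_SomeP; rewrite -?wf_tabE.
case: pickP => [p pd|none].
  by have [u -> Ep] := pdP p pd; rewrite /m ffunE Ep.
case E: (inb d I v) => [u|] //=; have [vu wv wu lv lu] := nb_inP E.
have uv : iadj I u v by rewrite iadjC.
have := none (iport I v u); rewrite /port_dir /m !ffunE pnbr_port //=.
by rewrite (tab_port uv) !wf_tabE wv wu; move: lv lu; rewrite /lab => -> ->; rewrite !eqxx.
Qed.

Lemma loc_oapp_nb d t X (x : X) (f : inst n -> 'I_n -> X) : loc t f ->
  loc t.+1 (fun I v => oapp (f I) x (inb d I v)).
Proof.
move/(loc_nb d)/(loc_map (odflt x)); apply: loc_ext => I v; by case: (inb d I v).
Qed.

Lemma loc_exists (P : pred Sin) t : loc t (fun I v => [exists u, iadj I v u && P (iinp I v u)]).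
Proof.
apply: (loc_ext (f := fun I v => [exists p, oapp P false (tab I v p)])); last first.
  exact: (loc_map (fun s : {ffun 'I_Delta -> option Sin} => [exists p, oapp P false (s p)]) (loc_tab t)).
move=> I v; apply/existsP/existsP => [[p]|[u /andP[vu Pu]]].
  rewrite ffunE; case E: (pnbr I v p) => [u|] //= Pu; have [vu _] := iffLR (pnbrP _ _ _ _) E.
  by exists u; rewrite vu.
by exists (iport I v u); rewrite tab_port.
Qed.

Lemma loc_tyA t : loc t (fun I => tyA (iadj I) (iinp I)).
Proof. exact: (loc_exists (fun s => s.1.2)). Qed.

Lemma loc_bit t : loc t (fun I => bit (iadj I) (iinp I)).
Proof. exact: (loc_exists (fun s => s.2)). Qed.

Lemma loc_prd t X (f : inst n -> 'I_n -> X) : loc t f -> loc t.+1 (fun I v => omap (f I) (iprd I v)).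
Proof.
move=> lf; apply: (loc_ext (f := fun I v => if tyA (iadj I) (iinp I) v
   then omap (f I) (inb Lft I v) else omap (f I) (inb Prv I v))).
  by move=> I v; rewrite /prd; case: ifP.
apply: loc_if; [exact: loc_tyA | exact: loc_nb | exact: loc_nb].
Qed.

Lemma loc_par t X (x : X) (f : inst n -> 'I_n -> X) : loc t f ->
  loc t.+1 (fun I v => oapp (f I) x (ipar I v)).
Proof.
move=> lf; apply: (loc_ext (f := fun I v =>
  odflt (oapp (f I) x (inb (Par true) I v)) (omap (f I) (inb (Par false) I v)))).
  by move=> I v; rewrite /par; case: (inb (Par false) I v).
apply: loc_map2; [exact: loc_oapp_nb | exact: loc_nb].
Qed.

Lemma loc_side t : loc t.+1 (fun I => side (iadj I) (iinp I)).
Proof.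
have := @loc_nb (Par false) t _ _ (loc_const t tt).
move/(loc_map (fun o => ~~ isSome o)); apply: loc_ext => I v; by rewrite /side; case: nb.
Qed.

Lemma loc_kids t : loc t.+1 (fun I => kids (iadj I) (iinp I)).
Proof.
have L d := loc_map isSome (@loc_nb d t _ _ (loc_const t tt)).
have := loc_map2 pair (L (Chd false)) (L (Chd true)).
by apply: loc_ext => I v; rewrite /kids; congr (_, _); case: nb.
Qed.

(** The equalities of nodes in [valid] are decided by comparing transmitted identifiers. *)
Lemma eq_iid I (o o' : option 'I_n) : (o == o') = (omap (iid I) o == omap (iid I) o').
Proof. by case: o o' => [x|] [y|] //=; rewrite !(inj_eq (@Some_inj _)) (inj_eq (@iid_inj _ I)). Qed.

Lemma omap_obind X Y Z (h : Y -> Z) (g : X -> option Y) (o : option X) :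
  omap h (obind g o) = obind id (omap (fun x => omap h (g x)) o).
Proof. by case: o. Qed.

Lemma loc_chd_ok i : loc 2 (fun I v => chd_ok (iadj I) (iinp I) v i).
Proof.
have l0 := loc_nb (Chd false) (loc_id 1).
have lp d := loc_map (obind id) (loc_prd (loc_nb d (loc_id 0))).
have lu := loc_nb (Chd i) (loc_map2 pair (loc_tyA 1) (loc_prd (loc_id 0))).
pose F (x : option (bool * option nat)) a (y z w : option nat) :=
  if x is Some (b, q) then (b ==> a) && (q == if b && i then y else if b || i then z else w) else true.
have := loc_app (loc_app (loc_app (loc_map2 F lu (loc_tyA 2)) l0) (lp (Chd true))) (lp (Chd false)).
apply: loc_ext => I v; rewrite /chd_ok /F.
case: (nb _ _ (Chd i) v) => [u|] //=; rewrite (eq_iid I) -!omap_obind -!(fun_if (omap _)).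
congr (_ && (_ == omap _ _)); case: ifP => // _; by case: ifP.
Qed.

Lemma loc_valid : loc 2 (fun I => valid (iadj I) (iinp I)).
Proof.
have ln d := loc_nb d (loc_id 1).
have lnn d d' := loc_map (obind id) (loc_nb d (loc_nb d' (loc_id 0))).
have lk := loc_map2 pair (loc_kids 1) (loc_tyA 2).
have lkR := loc_nb Rgt (loc_kids 0).
have lkp := loc_prd (loc_map2 pair (loc_kids 0) (loc_tyA 1)).
have lp := loc_par false (loc_const 1 true).
have lc := loc_map2 andb (loc_chd_ok false) (loc_chd_ok true).
pose F (a b r0 r1 c : option nat) (k : bool * bool * bool) (kR : option (bool * bool))
  (kp : option (bool * bool * bool)) (p ok : bool) :=
  [&& isSome b == isSome a, r0 == b, r1 == c, oapp (fun x => x == k.1) true kR,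
    oapp (fun x => (x.1 == k.1) && (x.2 == k.2)) true kp, p || ~~ isSome kp & ok].
have := loc_app (loc_app (loc_app (loc_app (loc_app (loc_app (loc_app (loc_app
  (loc_map2 F (ln (Chd false)) (ln (Chd true))) (lnn (Chd false) Rgt)) (lnn (Chd true) Rgt))
  (lnn Rgt (Chd false))) lk) lkR) lkp) lp) lc.
apply: loc_ext => I v; rewrite /valid /F -!omap_obind -!eq_iid.
congr [&& _, _, _, _, _, _ & _].
- by do 2!case: nb.
- by case: (nb _ _ Rgt v).
- by case: (prd _ _ v).
by case: (par _ _ v); case: (prd _ _ v).
Qed.

Lemma loc_err_below k : loc (2 + k) (fun I => err_below (iadj I) (iinp I) k).
Proof.
elim: k => [|k IHk]; first exact: loc_const.
rewrite addnS; have lv := loc_le (leqW (leq_addr k 2)) loc_valid.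
have := loc_map2 orb (loc_map negb lv) (loc_map2 orb (loc_oapp_nb (Chd false) false IHk)
  (loc_oapp_nb (Chd true) false IHk)).
exact: loc_ext.
Qed.

Lemma loc_err_above K k : loc (2 + K + k) (fun I => err_above (iadj I) (iinp I) K k).
Proof.
elim: k => [|k IHk]; first exact: loc_const.
rewrite addnS; have lb := loc_le (leqW (leq_addr k (2 + K))) (loc_err_below K).
have := loc_map2 orb lb (loc_par false IHk).
exact: loc_ext.
Qed.

Lemma loc_down k w : loc k (fun I v => down (iadj I) (iinp I) k v w).
Proof.
elim: k w => [|k IHk] [|i w]; try exact: loc_bit; first exact: loc_const.
have := loc_oapp_nb (Chd i) false (IHk w); exact: loc_ext.
Qed.

Lemma loc_row_bit K k w : loc (K + k) (fun I v => row_bit (iadj I) (iinp I) K k v w).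
Proof.
elim: k w => [|k IHk] w; first exact: loc_const.
rewrite addnS.
have ld := loc_le (leqW (leq_addr k K)) (loc_down K w).
have lb := loc_map2 (fun a s => ~~ a && s) (loc_tyA (K + k).+1) (loc_side (K + k)).
have lr i := loc_par None (loc_map Some (IHk (i :: w))).
have := loc_map2 (odflt (T := bool)) ld (loc_if lb (lr true) (lr false)).
apply: loc_ext => I v /=; case: (par _ _ v) => [p|] /=; last by rewrite if_same.
by case: (_ && _).
Qed.

Definition tree_out I K L v : Sout :=
  (err_below (iadj I) (iinp I) K v, err_above (iadj I) (iinp I) K K v, row_bit (iadj I) (iinp I) K L v [::]).

Lemma loc_tree_out K L : L <= K -> loc (2 + K + K) (fun I v => tree_out I K L v).
Proof.
move=> LK; apply: loc_map2; first (apply: loc_map2).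
- by apply: loc_le (loc_err_below K); rewrite leq_addr.
- exact: loc_err_above.
apply: loc_le (loc_row_bit K L [::]); lia.
Qed.

End Local.

Lemma tree_upper c : exists A : AlgoFor treeLCL, det_solves c A /\
  exists K, forall n, rounds A n <= K * (trunc_log 2 n).+1.
Proof.
pose L n := (trunc_log 2 n).+1.
pose g n := sval (loc_tree_out n (leqnSn (L n))).
(* The number of rounds is [2 * L n + 4], which is at most [6 * L n] since [L n] is positive. *)
exists (view_algo (fun n => 2 + (L n).+1 + (L n).+1) g); split; last by exists 6 => n /=; rewrite /L; lia.
split=> // n adj port id inp [_ adjI adjC _ adjD] portP [id_inj _] t.
pose I := Inst inp adjC portP id_inj.
apply: chk_valid_out => //.
apply: (@labels_chk _ _ _ adjC (L n).+1 (L n)) => // [|v u _]; first exact: trunc_log_ltn.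
rewrite /out_lab (exec_uview I) /= /g.
by case: (loc_tree_out _ _) => /= h <-.
Qed.

(** * The hard instance *)

Notation lv := (trunc_log 2).

Lemma lv_bounds X : 0 < X -> 2 ^ lv X <= X < 2 * 2 ^ lv X.
Proof. by move=> X0; rewrite -expnS; exact: trunc_log_bounds. Qed.

Lemma lvP X k : 2 ^ k <= X < 2 * 2 ^ k -> lv X = k.
Proof. by rewrite -expnS; exact: trunc_log_eq. Qed.

Lemma lv_dbl X (i : bool) : 0 < X -> lv (2 * X + i) = (lv X).+1.
Proof. by move=> X0; apply: lvP; rewrite expnS; have := lv_bounds X0; lia. Qed.

Lemma lt_pow_lv X k : 0 < X -> (X < 2 ^ k) = (lv X < k).
Proof.
move=> X0; apply/idP/idP => H; last first.
  by apply: leq_trans (trunc_log_ltn X (ltnSn 1)) _; rewrite leq_exp2l.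
have /andP[XX _] := lv_bounds X0.
by rewrite -(ltn_exp2l _ _ (ltnSn 1)); apply: leq_ltn_trans H.
Qed.

Section Heap.
Variable a : nat.

(** Nodes are numbered like a binary heap: the root is 1 and the children of [X]
    are [2 X] and [2 X + 1].  The tree has depth [2 a], hence the numbers below
    [core_size]; larger numbers form a path that pads the graph to the required
    size.  The [2 ^ a] nodes of depth [a] head the columns, and a node of depth
    [k >= a] is [2 ^ (k - a)] positions away from its neighbours in its row. *)
Definition core_size : nat := 2 ^ (2 * a).+1.
Definition row_shift (X : nat) : nat := 2 ^ (lv X - a).

(** Down to depth [a] the row shift is 1 and a row link would repeat the level link, whence the test
    [a < lv X]; there [prd] follows [Lft]. *)
Definition hdir (X Y : nat) : option dir :=
  if (X < core_size) && (Y < core_size) then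
    if Y./2 == X then Some (Chd (odd Y))
    else if X./2 == Y then Some (Par (odd X))
    else if lv X != lv Y then None
    else if Y == X + 1 then Some Rgt
    else if X == Y + 1 then Some Lft
    else if a < lv X then
      if Y == X + row_shift X then Some Nxt else if X == Y + row_shift X then Some Prv else None
    else None
  else if Y == X + 1 then Some (Jnk true)
  else if X == Y + 1 then Some (Jnk false) else None.

Definition hspec (d : dir) (X Y : nat) : Prop :=
  match d with
  | Chd i => [/\ X < core_size, Y < core_size & Y = 2 * X + i]
  | Par i => [/\ X < core_size, Y < core_size & X = 2 * Y + i]
  | Rgt => [/\ X < core_size, Y < core_size, lv X = lv Y & Y = X + 1]
  | Lft => [/\ X < core_size, Y < core_size, lv X = lv Y & X = Y + 1]
  | Nxt => [/\ X < core_size, Y < core_size, lv X = lv Y, a < lv X & Y = X + row_shift X]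
  | Prv => [/\ X < core_size, Y < core_size, lv X = lv Y, a < lv X & X = Y + row_shift X]
  | Jnk true => (core_size <= X \/ core_size <= Y) /\ Y = X + 1
  | Jnk false => (core_size <= X \/ core_size <= Y) /\ X = Y + 1
  end.

Lemma shift_gt1 X : a < lv X -> 1 < row_shift X.
Proof. by move=> H; rewrite /row_shift -{1}(expn0 2) ltn_exp2l // subn_gt0. Qed.

Lemma lv_half X Y : 0 < Y -> X./2 = Y -> lv X <> lv Y.
Proof. 
move=> Y0 E; have X1 : 1 < X by lia.
by rewrite (trunc_log2S X1) E => /esym/n_Sn.
Qed.

(** The order of the tests in [hdir] is immaterial: tree edges change the level, and below depth [a]
    row links are longer than level links. *)
Lemma hdirP d X Y : 0 < X -> 0 < Y -> hdir X Y = Some d <-> hspec d X Y.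
Proof.
move=> X0 Y0; rewrite /hdir; case: ifP => [/andP[XQ YQ]|nQ]; last first.
  case: eqP => [EY|NY].
    split=> [[<-]|]; first by split=> //; lia.
    by case: d => [i|i|||||[]] //=; case; lia.
  case: eqP => [EX|NX].
    split=> [[<-]|]; first by split=> //; lia.
    by case: d => [i|i|||||[]] //=; case; lia.
  split=> //; case: d => [i|i|||||[]] //=; case; lia.
case: eqP => [EY|NY].
  have lXY := @lv_half Y X X0 EY.
  split=> [[<-]|]; first by split=> //; lia.
  case: d => [i|i|||||[]] //=; try (by case=> _ _ E; congr (Some (Chd _)); lia); by case; lia.
case: eqP => [EX|NX].
  have lXY := @lv_half X Y Y0 EX.
  split=> [[<-]|]; first by split=> //; lia.
  case: d => [i|i|||||[]] //=; try (by case=> _ _ E; congr (Some (Par _)); lia); by case; lia.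
case: eqP => [lXY|nlXY] /=; last first.
  split=> //; case: d => [i|i|||||[]] //=; case; lia.
case: eqP => [EY|NY1].
  split=> [[<-]|]; first by split=> //; lia.
  case: d => [i|i|||||[]] //=; try (by case; lia); by case=> _ _ _ /shift_gt1; lia.
case: eqP => [EX|NX1].
  split=> [[<-]|]; first by split=> //; lia.
  case: d => [i|i|||||[]] //=; try (by case; lia); by case=> _ _ _ /shift_gt1; lia.
case: ltnP => aX; last first.
  split=> //; case: d => [i|i|||||[]] //=; case; lia.
have := shift_gt1 aX => s1.
case: eqP => [EY|NY2].
  split=> [[<-]|]; first by split=> //; lia.
  by case: d => [i|i|||||[]] //=; case; lia.
case: eqP => [EX|NX2].
  split=> [[<-]|]; first by split=> //; lia.
  by case: d => [i|i|||||[]] //=; case; lia.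
split=> //; case: d => [i|i|||||[]] //=; case; lia.
Qed.

Lemma hspecC d X Y : hspec d X Y -> hspec (opp d) Y X.
Proof.
case: d => [i|i|||||[]] //=; rewrite /row_shift; try (by case=> *; split; lia).
- by case=> ? ? E ? ?; rewrite -E; split.
- by case=> ? ? E ? ?; rewrite -E; split.
Qed.

Lemma hdirC X Y : 0 < X -> 0 < Y -> hdir Y X = omap opp (hdir X Y).
Proof.
move=> X0 Y0; case E: (hdir X Y) => [d|] /=.
  by apply/(hdirP _ Y0 X0)/hspecC/(hdirP _ X0 Y0).
case E': (hdir Y X) => [d|] //; move/(hdirP _ Y0 X0)/hspecC/(hdirP _ X0 Y0): E'.
by rewrite E.
Qed.

Lemma hspec_inj d e X Y Z : samekey d e -> hspec d X Y -> hspec e X Z -> Y = Z.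
Proof.
case: (d =P e) => [<- _|]; last first.
  by case: d e => [i|i|||||i] [j|j|||||j] //= ne; try (by move/eqP/ne); move=> _ [? ? ?] [? ? ?]; lia.
by case: d => [i|i|||||[]] /=; case=> [? ? ?] *; match goal with H : _ |- _ => case: H => *; lia end.
Qed.
End Heap.

Section Hard.
Variables (n a : nat) (xf : nat -> bool).
Local Notation Q := (core_size a).
Local Notation shift := (row_shift a).
Local Notation hdir := (hdir a).
Implicit Types x u : 'I_n.

(** The ordinal [x] stands for the heap number [x.+1], as the root is 1. *)
Definition hadj : rel 'I_n := fun x u => hdir x.+1 u.+1.
Definition hlab x u : dir := odflt (Jnk true) (hdir x.+1 u.+1).
(** The leaves of the first column, which hold the data bits. *)
Definition first_leaf (X : nat) : bool := 2 ^ (2 * a) <= X < 2 ^ (2 * a) + 2 ^ a.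
Definition hinp x u : Sin :=
  (hlab x u, x.+1 < 2 ^ a.+1, first_leaf x.+1 && xf (x.+1 - 2 ^ (2 * a))).
(** As [Delta] counts the labels, the label of a half-edge can serve as its port; it does not depend
    on the data bits. *)
Definition hport x u : 'I_Delta := enum_rank (hlab x u).

Lemma hlabP x u d : hadj x u -> hlab x u = d -> hspec a d x.+1 u.+1.
Proof. by rewrite /hadj /hlab; case E: (hdir _ _) => [e|] //= _ <-; apply/hdirP. Qed.

Lemma hadjC : symmetric hadj.
Proof. by move=> x u; rewrite /hadj (hdirC a (ltn0Sn x) (ltn0Sn u)); case: (hdir _ _). Qed.

Lemma hadj_irr : irreflexive hadj.
Proof.
move=> x; apply/negP; rewrite /hadj; case E: (hdir _ _) => [d|] // _.
move/hdirP: E => /(_ isT isT); case: d => [i|i|||||[]] /=; case; try lia.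
- by move=> _ _ _ /shift_gt1; lia.
- by move=> _ _ _ /shift_gt1; lia.
Qed.

Lemma hlab_inj x u w : hadj x u -> hadj x w -> samekey (hlab x u) (hlab x w) -> u = w.
Proof.
move=> xu xw k; apply: val_inj; apply: succn_inj.
exact: (hspec_inj k (hlabP xu erefl) (hlabP xw erefl)).
Qed.

Lemma hport_ok : port_ok hadj hport.
Proof.
move=> x u w xu xw /enum_rank_inj E; apply: (hlab_inj xu xw); rewrite E; exact: samekey_refl.
Qed.

Lemma hadj_deg x : #|[set u | hadj x u]| <= Delta.
Proof.
rewrite -(@card_in_imset _ _ (hlab x)); first exact: max_card.
move=> u w; rewrite !inE => xu xw E; apply: (hlab_inj xu xw); rewrite E; exact: samekey_refl.
Qed.

Lemma hadj_spec x u d : hspec a d x.+1 u.+1 -> hadj x u.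
Proof. by move=> /hdirP; rewrite /hadj => ->. Qed.

Lemma hwf x : wf hadj hinp x.
Proof.
apply/forallP => u; apply/forallP => w; apply/implyP => xu; apply/implyP => xw; apply/implyP => k.
by apply/eqP; apply: hlab_inj k.
Qed.

Lemma nbP d x u : nb hadj hinp d x = Some u <-> hspec a d x.+1 u.+1.
Proof.
split=> [/nb_inP[xu _ _ lx _]|S]; first exact: hlabP lx.
have xu := hadj_spec S.
apply: nb_SomeP; rewrite ?hwf // /lab /= /hlab.
  by move/hdirP: S => ->.
by move/hspecC/hdirP: S => ->.
Qed.

Hypothesis a_gt0 : 0 < a.
Hypothesis Qn : Q <= n.+1.

(** Gives connectivity by descent to the root: through the parent inside the tree, through the
    previous node on the padding path. *)
Lemma hparent x : 1 < x.+1 -> exists u, hadj x u /\ u < x.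
Proof.
move=> x1; case: (ltnP x.+1 Q) => xQ.
  have h : (x.+1)./2.-1 < n by have := ltn_ord x; lia.
  exists (Ordinal h); split; last by rewrite /=; lia.
  apply: (@hadj_spec _ _ (Par (odd x.+1))); rewrite /=; split=> //; lia.
have h : x.-1 < n by have := ltn_ord x; lia.
exists (Ordinal h); split; last by rewrite /=; lia.
by apply: (@hadj_spec _ _ (Jnk false)); rewrite /=; split; lia.
Qed.

Lemma Q_gt3 : 3 < Q.
Proof.
have : 2 ^ 2 <= 2 ^ (2 * a).+1 by rewrite leq_exp2l //; lia.
by rewrite /core_size.
Qed.

Lemma n_gt0 : 0 < n.
Proof. have := Q_gt3; lia. Qed.

Lemma hadj_connect x u : connect hadj x u.
Proof.
pose r := Ordinal n_gt0.
have cr : forall k x, x < k -> connect hadj x r.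
  elim=> // k IHk y; rewrite ltnS => yk; case: (posnP y) => y0.
    by rewrite (_ : y = r) ?connect0 //; apply: val_inj.
  have [z [yz zy]] := hparent (y0 : 1 < y.+1).
  by apply: connect_trans (connect1 yz) (IHk _ _); apply: leq_trans zy yk.
apply: connect_trans (cr _ x (ltnSn x)) _.
by rewrite (sym_connect_sym hadjC); apply: cr (ltnSn u).
Qed.

Lemma hgood : good_graph Delta hadj.
Proof.
split; [exact: n_gt0|exact: hadj_irr|exact: hadjC|exact: hadj_connect|exact: hadj_deg].
Qed.

Lemma hhas_nbr x : exists u, hadj x u.
Proof.
case: (posnP x) => x0; last by have [u [xu _]] := hparent (x0 : 1 < x.+1); exists u.
have h : 1 < n by have := Q_gt3; lia.
exists (Ordinal h); apply: (@hadj_spec _ _ (Chd false)); rewrite /=; have := Q_gt3; split; lia.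
Qed.

Lemma htyA x : tyA hadj hinp x = (x.+1 < 2 ^ a.+1).
Proof.
apply/existsP/idP => [[u /andP[_]]//|xA]; have [u xu] := hhas_nbr x; exists u.
by rewrite xu.
Qed.

Lemma hbit x : bit hadj hinp x = first_leaf x.+1 && xf (x.+1 - 2 ^ (2 * a)).
Proof.
apply/existsP/idP => [[u /andP[_]]//|xA]; have [u xu] := hhas_nbr x; exists u.
by rewrite xu.
Qed.

(** * The hard instance has no structural error *)

Definition heap (o : option 'I_n) : option nat := omap (fun u => u.+1) o.

Lemma heap_inj : injective heap.
Proof. by move=> [x|] [u|] //= [E]; congr Some; apply: val_inj. Qed.

(** The arithmetic form of [nb], which turns validity into identities between numbers. The value
    [None] for the remaining directions is a placeholder. *)
Definition hstep (d : dir) (X : nat) : option nat :=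
  match d with
  | Chd i => if 2 * X + i < Q then Some (2 * X + i) else None
  | Rgt => if (X + 1 < Q) && (lv X == lv (X + 1)) then Some (X + 1) else None
  | _ => None
  end.

(** One formula serves both types of level, as the shift is 1 on those of type A. *)
Definition hprd (X : nat) : option nat :=
  if (X < Q) && (2 ^ lv X + shift X <= X) then Some (X - shift X) else None.

Lemma heap_nb_Some d x Y : 0 < Y -> Y < Q -> hspec a d x.+1 Y -> heap (nb hadj hinp d x) = Some Y.
Proof.
move=> Y0 YQ S; have h : Y.-1 < n by lia.
by rewrite (iffRL (nbP d x (Ordinal h))) /= prednK.
Qed.

Lemma heap_nb_None d x : (forall Y, 0 < Y -> ~ hspec a d x.+1 Y) -> heap (nb hadj hinp d x) = None.
Proof.
by move=> N; case E: (nb _ _ _ _) => [u|] //; case: (N u.+1 isT); apply/nbP.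
Qed.

Lemma heap_chd i x : heap (nb hadj hinp (Chd i) x) = hstep (Chd i) x.+1.
Proof.
rewrite /=; case: ifP => xQ; first by apply: heap_nb_Some => //=; split; lia.
by apply: heap_nb_None => Y _ [_ YQ E]; rewrite -E YQ in xQ.
Qed.

Lemma heap_rgt x : heap (nb hadj hinp Rgt x) = hstep Rgt x.+1.
Proof.
rewrite [RHS]/=; case: ifP => [/andP[xQ /eqP lx]|xQ].
  by apply: heap_nb_Some; rewrite /=; try lia; split=> //; lia.
apply: heap_nb_None => Y _ [_ YQ lY E]; move: xQ; rewrite -E YQ lY eqxx //.
Qed.

Lemma shiftA X : 0 < X -> X < 2 ^ a.+1 -> shift X = 1.
Proof. by move=> X0; rewrite lt_pow_lv // ltnS /row_shift => /eqP ->. Qed.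

Lemma lv_same X Y : 0 < X -> 0 < Y -> lv X = lv Y <-> 2 ^ lv X <= Y < 2 * 2 ^ lv X.
Proof.
move=> X0 Y0; split=> [->|]; first exact: lv_bounds.
by move/lvP.
Qed.

Lemma heap_prd x : heap (prd hadj hinp x) = hprd x.+1.
Proof.
have /andP[b1 b2] := lv_bounds (ltn0Sn x).
rewrite /prd htyA /hprd; case: ifP => xA.
  rewrite (shiftA (ltn0Sn x) xA); case: ifP => [/andP[xQ le]|nx].
    have p0 : 0 < 2 ^ lv x.+1 by rewrite expn_gt0.
    apply: heap_nb_Some; try lia; split; try lia.
    by apply/lv_same; lia.
  apply: heap_nb_None => Y Y0 [xQ YQ lY E]; move: nx; rewrite xQ /= => /negP; apply.
  by have /andP[] := lv_bounds Y0; rewrite -lY; lia.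
move/negbT: xA; rewrite lt_pow_lv // -leqNgt => xA.
have s2 : shift x.+1 < 2 ^ lv x.+1 by rewrite /row_shift ltn_exp2l //; lia.
case: ifP => [/andP[xQ le]|nx].
  apply: heap_nb_Some; try lia; split; try lia.
  by apply/lv_same; lia.
apply: heap_nb_None => Y Y0 [xQ YQ lY _ E]; move: nx; rewrite xQ /= => /negP; apply.
by have /andP[] := lv_bounds Y0; rewrite -lY; lia.
Qed.

Lemma heap_obind (f : 'I_n -> option 'I_n) g o : (forall u, heap (f u) = g u.+1) ->
  heap (obind f o) = obind g (heap o).
Proof. by case: o => //= u; apply. Qed.

Lemma heap_eq (o o' : option 'I_n) : heap o = heap o' -> o == o'.
Proof. by move/heap_inj ->. Qed.

Lemma isSome_heap o : isSome o = isSome (heap o).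
Proof. by case: o. Qed.

Lemma hkids x : kids hadj hinp x = (2 * x.+1 < Q, 2 * x.+1 < Q).
Proof.
rewrite /kids 2!(isSome_heap (nb _ _ _ _)) !heap_chd /=.
have E : Q = 2 * 2 ^ (2 * a) by rewrite /core_size expnS.
congr (_, _); case: ifP => /=; lia.
Qed.

Lemma kid_lv X Y : 0 < X -> 0 < Y -> lv X = lv Y -> (2 * X < Q) = (2 * Y < Q).
Proof. by move=> X0 Y0 E; rewrite /core_size expnS !ltn_pmul2l // !lt_pow_lv // E. Qed.

Lemma hprd_lv X Y : 0 < X -> hprd X = Some Y -> [/\ X < Q, Y + shift X = X, 0 < Y & lv Y = lv X].
Proof.
move=> X0; rewrite /hprd; case: ifP => // /andP[XQ le] [<-].
have /andP[b1 b2] := lv_bounds X0; have p0 : 0 < 2 ^ lv X by rewrite expn_gt0.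
by split=> //; try lia; apply: lvP; lia.
Qed.

Lemma hstep_rgt0 X : 0 < X -> obind (hstep Rgt) (hstep (Chd false) X) = hstep (Chd true) X.
Proof.
move=> X0; have E : Q = 2 * 2 ^ (2 * a) by rewrite /core_size expnS.
rewrite /hstep; case: ifP => /= XQ; last by case: ifP => // XQ'; lia.
rewrite (lv_dbl false X0) -addnA (lv_dbl true X0) eqxx andbT.
by [].
Qed.

Lemma hstep_rgt1 X : 0 < X ->
  obind (hstep Rgt) (hstep (Chd true) X) = obind (hstep (Chd false)) (hstep Rgt X).
Proof.
move=> X0; have E : Q = 2 * 2 ^ (2 * a) by rewrite /core_size expnS.
have EX : 2 * X + true + 1 = 2 * (X + 1) + false by lia.
have X1 : 0 < X + 1 by lia.
rewrite /hstep; case: (ifP (2 * X + true < Q)) => /= XQ; last first.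
  by case: ifP => //= XQ'; case: ifP => // XQ''; lia.
rewrite EX (lv_dbl true X0) (lv_dbl false X1) eqSS; case: (lv X == lv (X + 1)); last by rewrite !andbF.
rewrite !andbT; case: (ltnP (X + 1) Q) => //= XQ'.
by case: ifP => // XQ''; lia.
Qed.

(** From depth [a] on the shift doubles with each level, and [2 * X + i - 2 * s] is
    [2 * (X - s) + i]. Above, it stays 1: [2 * X + 1] follows [2 * X], which follows
    [2 * (X - 1) + 1]. *)
Lemma hprd_chd X (i : bool) : 0 < X -> 2 * X + i < Q ->
  hprd (2 * X + i) = if (2 * X + i < 2 ^ a.+1) && i then Some (2 * X)
    else obind (hstep (Chd ((2 * X + i < 2 ^ a.+1) || i))) (hprd X).
Proof.
move=> X0 UQ; have U0 : 0 < 2 * X + i by lia.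
have [/andP[b1 b2] p0] : 2 ^ lv X <= X < 2 * 2 ^ lv X /\ 0 < 2 ^ lv X.
  by rewrite expn_gt0; split=> //; exact: lv_bounds.
have XQ : X < Q by lia.
rewrite /hprd UQ XQ /= /row_shift lt_pow_lv // (lv_dbl i X0) expnS ltnS.
case: (leqP (lv X).+1 a) => la /=.
  have -> : (lv X).+1 - a = 0 by lia.
  have -> : lv X - a = 0 by lia.
  rewrite expn0; case: i {U0} UQ => UQ /=.
    by rewrite ifT; [congr Some|]; lia.
  case: (leqP (2 ^ lv X + 1) X) => lX /=; last by rewrite ifF //; lia.
  rewrite ifT; last by lia.
  by rewrite ifT; [congr Some|]; lia.
have -> : (lv X).+1 - a = (lv X - a).+1 by lia.
rewrite expnS; set s := 2 ^ (lv X - a).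
case: (leqP (2 ^ lv X + s) X) => lX /=; last by rewrite ifF //; lia.
rewrite ifT; last by lia.
by rewrite ifT; [congr Some|]; lia.
Qed.

Lemma hvalid x : valid hadj hinp x.
Proof.
have [k0 k1] := hkids x.
have ko (u : 'I_n) : lv u.+1 = lv x.+1 -> kids hadj hinp u == kids hadj hinp x.
  by move=> E; rewrite !hkids (kid_lv _ _ E).
have hc i : chd_ok hadj hinp x i.
  rewrite /chd_ok; case E: (nb _ _ _ _) => [u|] //; have /= [xQ uQ Eu] := iffLR (nbP _ _ _) E.
  rewrite !htyA; apply/andP; split; first by apply/implyP; lia.
  apply: heap_eq; rewrite heap_prd Eu.
  have -> := hprd_chd (ltn0Sn x) (_ : 2 * x.+1 + i < Q); last by rewrite -Eu.
  rewrite (fun_if heap) (heap_obind (g := hstep (Chd ((2 * x.+1 + i < 2 ^ a.+1) || i)))).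
    rewrite heap_prd heap_chd; case: ifP => // _.
    by rewrite /= addn0 ifT //; lia.
  by move=> w; rewrite heap_chd.
apply/and5P; split.
- by rewrite k0 k1.
- by apply: heap_eq; rewrite (heap_obind (g := hstep Rgt) _ heap_rgt) !heap_chd hstep_rgt0.
- apply: heap_eq; rewrite (heap_obind (g := hstep Rgt) _ heap_rgt) (heap_obind (g := hstep (Chd false))).
    by rewrite heap_rgt heap_chd hstep_rgt1.
  exact: heap_chd.
- case E: (nb _ _ _ _) => [u|] //; have /= [_ _ El _] := iffLR (nbP _ _ _) E; exact: ko.
apply/and4P; split => //.
  case E: (prd _ _ _) => [u|] //; have := heap_prd x; rewrite E => /esym/(hprd_lv (ltn0Sn x))[_ _ _ lu].
  by rewrite ko // !htyA !lt_pow_lv // lu eqxx.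
case E: (prd _ _ _) => [u|]; last by rewrite orbT.
have := heap_prd x; rewrite E => /esym/(hprd_lv (ltn0Sn x))[xQ Eu _ _].
have s0 : 0 < shift x.+1 by rewrite expn_gt0.
have h : (x.+1)./2.-1 < n by have := ltn_ord x; lia.
have : nb hadj hinp (Par (odd x.+1)) x = Some (Ordinal h).
  by apply/nbP; rewrite /=; split; lia.
by rewrite /par orbF; case: (odd _) => ->; case: (nb hadj hinp (Par false) x).
Qed.

(** * Outputs forced on the hard instance *)

Section Valid.
Variable out : 'I_n -> 'I_n -> Sout.
Hypothesis chk_out : forall x, chk hadj hinp out x.

(** Every node is valid, so a claim would be passed on to ever larger heap numbers. *)
Lemma hard_noU x : ~~ outU hadj out x.
Proof.
have [m] := ubnP (n - x); elim: m x => // m IHm x; rewrite ltnS => xm.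
apply/negP => Ux; have /and3P[/implyP/(_ Ux) + _ _] := chk_out x; rewrite hvalid /=.
have nU i : ~~ oapp (outU hadj out) false (nb hadj hinp (Chd i) x).
  case E: (nb _ _ _ _) => [u|] //; have /= [_ _ Eu] := iffLR (nbP _ _ _) E.
  by apply: IHm; have := ltn_ord u; have := ltn_ord x; lia.
by rewrite (negbTE (nU false)) (negbTE (nU true)).
Qed.

(** Without [outU], the claim would be passed on to ever smaller heap numbers. *)
Lemma hard_noD x : ~~ outD hadj out x.
Proof.
have [m] := ubnP (x : nat); elim: m x => // m IHm x; rewrite ltnS => xm.
apply/negP => Dx; have /and3P[_ /implyP/(_ Dx) + _] := chk_out x.
rewrite (negbTE (hard_noU x)) /=; case E: (par _ _ _) => [u|] //=.
have /nbP/= [_ _ Eu] := par_chd hadjC E; apply/negP/IHm; lia.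
Qed.

(** Induction on the column [i]: leaves of consecutive columns are [2 ^ a] apart, and the bit is
    copied along the row from the first column. *)
Lemma hard_row j i x : j < 2 ^ a -> i < 2 ^ a -> x.+1 = 2 ^ (2 * a) + i * 2 ^ a + j ->
  outB hadj out x = xf j.
Proof.
move=> ja; elim: i x => [|i IHi] x ia Ex;
  have /and3P[_ _ /implyP/(_ (hard_noD x))/eqP ->] := chk_out x;
  have aa : 2 ^ (2 * a) = 2 ^ a * 2 ^ a by rewrite -expnD addnn mul2n.
all: have lx : lv x.+1 = 2 * a by apply: lvP; rewrite Ex aa; nia.
all: have sx : shift x.+1 = 2 ^ a by rewrite /row_shift lx mul2n -addnn addnK.
all: have := heap_prd x; rewrite /hprd sx lx.
  rewrite ifF; last by rewrite Ex; lia.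
  case: (prd _ _ _) => // _.
  rewrite hbit /first_leaf Ex mul0n addn0 leq_addr ltn_add2l ja /=.
  by congr xf; rewrite addKn.
have xQ : x.+1 < Q by rewrite /core_size expnS Ex aa; nia.
rewrite ifT; last by rewrite xQ Ex; nia.
case E: (prd _ _ _) => [u|] //= [Eu]; apply: IHi; first exact: ltnW.
by rewrite Eu Ex mulSn; lia.
Qed.
End Valid.
End Hard.

(** * Simulation *)

Section Region.
Variable a : nat.
Local Notation Q := (core_size a).
Local Notation shift := (row_shift a).

(** [X] lies over some column with index larger than [t]. *)
Definition right_of (t X : nat) : bool :=
  (Q <= X) || (if lv X <= a then t + 1 < (X + 1 - 2 ^ lv X) * 2 ^ (a - lv X)
               else (t + 1) * shift X <= X - 2 ^ lv X).

(** The last node of depth [k] all of whose columns have index at most [t]. *)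
Definition frontier (t k : nat) : nat := 2 ^ k + (t + 1) %/ 2 ^ (a - k) - 1.

Lemma right_of_up t X : X < Q -> lv X <= a ->
  right_of t X = (t + 1 < (X + 1 - 2 ^ lv X) * 2 ^ (a - lv X)).
Proof. by move=> XQ lX; rewrite /right_of leqNgt XQ lX. Qed.

Lemma right_of_low t X : 0 < X -> X < Q -> a <= lv X ->
  right_of t X = ((t + 1) * shift X <= X - 2 ^ lv X).
Proof.
move=> X0 XQ lX; have /andP[b1 _] := lv_bounds X0.
rewrite /right_of leqNgt XQ /= /row_shift; case: (leqP (lv X) a) => // la.
have lE : lv X = a by lia.
by move: b1; rewrite lE subnn !muln1; lia.
Qed.

Lemma right_of_mono t X : right_of t.+1 X -> right_of t X.
Proof. by rewrite /right_of; case: (Q <= X) => //=; case: ifP => _; nia. Qed.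

Lemma frontier_eq t k W : W + 1 >= 2 ^ k ->
  (W + 1 - 2 ^ k) * 2 ^ (a - k) <= t + 1 < (W + 2 - 2 ^ k) * 2 ^ (a - k) -> W = frontier t k.
Proof.
move=> kW /andP[le lt]; have p0 : 0 < 2 ^ (a - k) by rewrite expn_gt0.
have E : (t + 1) %/ 2 ^ (a - k) = W + 1 - 2 ^ k.
  apply/eqP; rewrite eqn_leq leq_divRL // le andbT -ltnS ltn_divLR //.
  by apply: leq_trans lt _; rewrite leq_mul2r; apply/orP; right; lia.
by rewrite /frontier E; lia.
Qed.

Hypothesis a_gt0 : 0 < a.

(** A row or level edge below depth [a] moves by at most one column, so in one
    round only the [a + 1] frontier nodes can influence the region. *)
Lemma frontier_cross t d X W : 0 < X -> 0 < W -> t + 1 < 2 ^ a -> hspec a d X W ->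
  right_of t.+1 X -> ~~ right_of t W -> exists2 k, k <= a & W = frontier t k.
Proof.
move=> X0 W0 ta; have [/andP[bX _] /andP[bW _]] := (lv_bounds X0, lv_bounds W0).
case: d => [i|i|||||[]] /=.
(* Only [Chd] and [Lft] edges ending at depth at most [a] can lead to a frontier node. In all other
   cases [W] still lies over a column beyond [t], a contradiction. *)
- move=> [XQ WQ EX]; have lX : lv X = (lv W).+1 by rewrite EX lv_dbl.
  have pX : 2 ^ lv X = 2 * 2 ^ lv W by rewrite lX expnS.
  case: (leqP (lv X) a) => la.
    rewrite !right_of_up //; last by lia.
    have -> : a - lv W = (a - lv X).+1 by lia.
    by rewrite expnS pX EX; nia.
  rewrite !right_of_low //; try lia.
  rewrite /row_shift pX lX subSn; last by lia.
  have s0 : 0 < 2 ^ (lv W - a) by rewrite expn_gt0.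
  by rewrite expnS EX; nia.
- move=> [XQ WQ EW]; have lW : lv W = (lv X).+1 by rewrite EW lv_dbl.
  have pW : 2 ^ lv W = 2 * 2 ^ lv X by rewrite lW expnS.
  case: (leqP (lv W) a) => la.
    rewrite !right_of_up //; last by lia.
    have -> : a - lv X = (a - lv W).+1 by lia.
    rewrite expnS pW => rX rW; exists (lv W) => //; apply: frontier_eq; first by lia.
    by rewrite pW EW; move: rX rW; rewrite EW; case: i {EW}; nia.
  rewrite !right_of_low //; try lia.
  rewrite /row_shift pW lW subSn; last by lia.
  have s0 : 0 < 2 ^ (lv X - a) by rewrite expn_gt0.
  by rewrite expnS EW; nia.
- move=> [XQ WQ lXW EX]; case: (leqP (lv X) a) => la.
    rewrite !right_of_up -?lXW // => rX rW; exists (lv X) => //.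
    by apply: frontier_eq; rewrite ?lXW; [lia|]; move: rX rW; rewrite lXW EX; nia.
  have s0 : 0 < 2 ^ (lv W - a) by rewrite expn_gt0.
  rewrite !right_of_low; try lia.
  by rewrite /row_shift lXW EX; nia.
- move=> [XQ WQ lXW EW]; case: (leqP (lv X) a) => la.
    by rewrite !right_of_up -?lXW // EW; nia.
  rewrite !right_of_low; try lia.
  by rewrite /row_shift -lXW EW; nia.
- move=> [XQ WQ lXW la EX].
  rewrite !right_of_low; try lia.
  rewrite {2}/row_shift -lXW -/(shift X).
  by move: EX; set s := shift X; nia.
- move=> [XQ WQ lXW la EW].
  rewrite !right_of_low; try lia.
  rewrite {2}/row_shift -lXW -/(shift X).
  by move: EW; set s := shift X; nia.
- by case=> QXW EW _; rewrite /right_of (_ : Q <= W) //; lia.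
(* The padding path is attached to the last leaf [Q - 1], which belongs to the last column and hence
   to the region. *)
case=> QXW EX _; case: (leqP Q W) => QW; first by rewrite /right_of QW.
have aa : 2 ^ (2 * a) = 2 ^ a * 2 ^ a by rewrite -expnD addnn mul2n.
have QE : Q = 2 * 2 ^ (2 * a) by rewrite /core_size expnS.
have EW : W = 2 * 2 ^ (2 * a) - 1 by lia.
have p0 : 0 < 2 ^ (2 * a) by rewrite expn_gt0.
have lW : lv W = 2 * a by apply: lvP; lia.
rewrite right_of_low //; last by rewrite lW; lia.
by rewrite /row_shift lW EW (_ : 2 * a - a = a); [rewrite aa; nia | lia].
Qed.

(** Base of the simulation: initial states inside the region do not depend on the data bits. *)
Lemma right_of_first_leaf X : right_of 0 X -> first_leaf a X = false.
Proof.
move=> rX; apply/negP => /andP[lo hi].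
have aa : 2 ^ (2 * a) = 2 ^ a * 2 ^ a by rewrite -expnD addnn mul2n.
have QE : Q = 2 * 2 ^ (2 * a) by rewrite /core_size expnS.
have p1 : 2 <= 2 ^ a by rewrite -{1}(expn1 2) leq_exp2l.
have lX : lv X = 2 * a by apply: lvP; nia.
move: rX; rewrite right_of_low; try nia.
by rewrite /row_shift lX (_ : 2 * a - a = a); lia.
Qed.

Lemma right_of_last t X : t + 1 < 2 ^ a -> 2 ^ (2 * a) + (2 ^ a - 1) * 2 ^ a <= X < Q -> right_of t X.
Proof.
move=> ta /andP[lo hi].
have aa : 2 ^ (2 * a) = 2 ^ a * 2 ^ a by rewrite -expnD addnn mul2n.
have QE : Q = 2 * 2 ^ (2 * a) by rewrite /core_size expnS.
have p1 : 2 <= 2 ^ a by rewrite -{1}(expn1 2) leq_exp2l.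
have lX : lv X = 2 * a by apply: lvP; nia.
rewrite right_of_low; try nia.
by rewrite /row_shift lX (_ : 2 * a - a = a); [nia|lia].
Qed.
End Region.

(** The final [true] marks the end of the message before the filling with [false], so messages of
    varying length embed into a finite type. *)
Definition pad (B : nat) (s : seq bool) : B.+1.-tuple bool :=
  [tuple nth false (rcons s true) i | i < B.+1].

Lemma pad_inj B s s' : size s <= B -> size s' <= B -> pad B s = pad B s' -> s = s'.
Proof.
move=> sB s'B E.
have nthE i : i <= B -> nth false (rcons s true) i = nth false (rcons s' true) i.
  by move=> iB; have := congr1 (fun t => tnth t (Ordinal (iB : i < B.+1))) E; rewrite !tnth_mktuple.
have sz u v : size u <= B -> size v <= B ->
    (forall i, i <= B -> nth false (rcons u true) i = nth false (rcons v true) i) -> size u <= size v.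
  move=> uB vB Euv; rewrite leqNgt; apply/negP => lt.
  have := Euv _ uB; rewrite nth_rcons ltnn eqxx nth_default // size_rcons //.
have ss : size s = size s'.
  by apply/eqP; rewrite eqn_leq !sz // => i iB; rewrite nthE.
apply: (@eq_from_nth _ false) => // i si; have := nthE i (leq_trans (ltnW si) sB).
by rewrite !nth_rcons si -ss si.
Qed.

Section Simulation.
Variables (A : Algo Delta Sin Sout) (b n a : nat) (tape : 'I_n -> seq bool).
Variable enc : Msg A -> seq bool.
Hypothesis enc_inj : injective enc.
Hypothesis enc_size : forall s p, size (enc (send A n s p)) <= b.
Hypothesis a_gt0 : 0 < a.
Hypothesis Qn : core_size a <= n.+1.

Local Notation state xf t :=
  (exec A (hadj (n:=n) a) (hport (n:=n) a) (@nat_of_ord n) (hinp a xf) tape t).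

Definition heap_node (X : nat) : 'I_n := insubd (Ordinal (n_gt0 a_gt0 Qn)) X.-1.

Lemma heap_nodeK (v : 'I_n) : heap_node v.+1 = v.
Proof. by rewrite /heap_node /= valKd. Qed.

(** Everything that enters the regions [right_of 1], ..., [right_of T]. *)
Definition transcript (T : nat) (xf : nat -> bool) : {ffun 'I_T * 'I_a.+1 * 'I_Delta -> b.+1.-tuple bool} :=
  [ffun c : 'I_T * 'I_a.+1 * 'I_Delta => pad b (enc (send A n (state xf c.1.1 (heap_node (frontier a c.1.1 c.1.2))) c.2))].

(** Induction on [t]: a message received inside the region comes either from a node of the previous
    region, whose states agree by induction, or from a frontier node, and then it is in the
    transcript. *)
Lemma simulation T xf xg t (v : 'I_n) : T < 2 ^ a -> transcript T xf = transcript T xg ->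
  t <= T -> right_of a t v.+1 -> state xf t v = state xg t v.
Proof.
move=> Ta Etr; elim: t v => [|t IHt] v tT rv /=.
  by rewrite /hinp (right_of_first_leaf a_gt0 rv).
rewrite IHt ?(ltnW tT) //; last exact: right_of_mono.
congr (recv A n _ _); apply: functional_extensionality => p.
rewrite /port_nbr; case: pickP => [u /andP[vu _]|//] /=; congr Some.
case: (boolP (right_of a t u.+1)) => [ru|nru]; first by rewrite IHt // ltnW.
have [|k ka Eu] := frontier_cross a_gt0 (ltn0Sn v) (ltn0Sn u) _ (hlabP vu erefl) rv nru.
  by apply: leq_ltn_trans Ta; rewrite addn1.
have := congr1 (fun g : {ffun _ -> _} => g (Ordinal tT, Ordinal (ka : k < a.+1), hport a u v)) Etr.
by rewrite !ffunE /= -Eu heap_nodeK => /pad_inj/enc_inj-> //; exact: enc_size.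
Qed.

(** The last column stays in the region for all [T] rounds, so its outputs are determined by the
    transcript; correctness makes them the data bits. *)
Lemma transcript_rows T xf xg : T.+1 < 2 ^ a -> T = rounds A n -> transcript T xf = transcript T xg ->
  @valid_out treeLCL n (hadj a) (hinp a xf) (out_lab A (hadj a) (hport a) (@nat_of_ord n) (hinp a xf) tape) ->
  @valid_out treeLCL n (hadj a) (hinp a xg) (out_lab A (hadj a) (hport a) (@nat_of_ord n) (hinp a xg) tape) ->
  forall j, j < 2 ^ a -> xf j = xg j.
Proof.
move=> Ta ET Etr Vf Vg j ja.
have aa : 2 ^ (2 * a) = 2 ^ a * 2 ^ a by rewrite -expnD addnn mul2n.
have QE : core_size a = 2 * 2 ^ (2 * a) by rewrite /core_size expnS.
have p0 : 0 < 2 ^ a by rewrite expn_gt0.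
set X := 2 ^ (2 * a) + (2 ^ a - 1) * 2 ^ a + j.
have XQ : X < core_size a by rewrite /X QE aa; nia.
have X0 : 0 < X by rewrite /X aa; nia.
have h : X.-1 < n by lia.
have EX : (Ordinal h).+1 = X by rewrite /= prednK.
have ia : 2 ^ a - 1 < 2 ^ a by lia.
have Rf := hard_row a_gt0 Qn (fun x => valid_out_chk x (@hadjC n a) Vf) ja ia EX.
have Rg := hard_row a_gt0 Qn (fun x => valid_out_chk x (@hadjC n a) Vg) ja ia EX.
rewrite -Rf -Rg; apply: eq_existsb => u; congr (_ && _.2).
rewrite /out_lab -ET (simulation _ Etr) //; first exact: ltnW.
by apply: right_of_last => //; rewrite ?addn1 // EX XQ leq_addr.
Qed.

End Simulation.

(** Some choice of the random bits succeeds on at least half of the inputs, and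
    on these the transcript determines the input. *)
Lemma tree_lower_pow c b (A : AlgoFor treeLCL) n a : 0 < c -> congest b A -> rand_solves c A ->
  0 < a -> core_size a <= n.+1 -> (rounds A n).+1 < 2 ^ a ->
  2 ^ a <= (rounds A n * a.+1 * Delta) * (b * (trunc_log 2 n).+1).+1 + 1.
Proof.
move=> c0 [enc [enc_inj enc_size]] solves a0 Qn Ta.
(* [E] is the length of a transcript in bits: rounds, frontier nodes, ports, and [B.+1] bits per
   padded message. *)
set T := rounds A n in Ta *; set B := b * _; set E := T * a.+1 * Delta * B.+1.
pose X := {ffun 'I_(2 ^ a) -> bool}.
pose tape := {ffun 'I_n -> (rbits A n).-tuple bool}.
pose xf (x : X) (k : nat) : bool := oapp x false (insub k).
pose ok (x : X) (t : tape) : bool := @valid_out treeLCL n (hadj a) (hinp a (xf x))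
  (out_lab A (hadj a) (hport a) (@nat_of_ord n) (hinp a (xf x)) (fun v => t v)).
have n1 : 1 < n by have := Q_gt3 a0 Qn; lia.
have ids : ids_ok c (@nat_of_ord n).
  split; first exact: ord_inj.
  by move=> v; apply: leq_trans (ltn_ord v) _; rewrite -{1}(expn1 n) leq_exp2l.
have good_x x : n.-1 * #|tape| <= n * #|[set t | ok x t]|.
  exact: (solves n (hadj a) (hport a) _ (hinp a (xf x)) (hgood a0 Qn) (@hport_ok n a) ids).
have good_t t : #|[set x | ok x t]| <= 2 ^ E.
  pose tr x := transcript B (fun v => t v : seq bool) enc a0 Qn T (xf x).
  rewrite -(@card_in_imset _ _ tr).
    apply: leq_trans (max_card _) _.
    by rewrite card_ffun card_tuple card_bool !card_prod !card_ord -expnM mulnC.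
  move=> x y; rewrite !inE => okx oky Etr; apply/ffunP => i.
  have esz s p : size (enc (send A n s p)) <= B by exact: enc_size.
  have := transcript_rows enc_inj esz Ta erefl Etr okx oky (ltn_ord i).
  by rewrite /xf valK.
(* Double counting of the successful pairs of an input and a tape. *)
have sum_le : \sum_(x : X) n.-1 * #|tape| <= n * (#|tape| * 2 ^ E).
  apply: (@leq_trans (\sum_(x : X) n * #|[set t | ok x t]|)); first by apply: leq_sum => x _; exact: good_x.
  rewrite -big_distrr leq_mul2l; apply/orP; right => /=.
  have -> : \sum_(x : X) #|[set t | ok x t]| = \sum_(t : tape) #|[set x | ok x t]|.
    under eq_bigr do rewrite -sum1_card big_mkcond.
    rewrite exchange_big; apply: eq_bigr => t _.
    by rewrite -sum1_card [in RHS]big_mkcond; apply: eq_bigr => x _; rewrite !inE.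
  apply: (@leq_trans (\sum_(t : tape) 2 ^ E)); first by apply: leq_sum => t _; exact: good_t.
  by rewrite sum_nat_const.
have tape_gt0 : 0 < #|tape| by apply/card_gt0P; exists [ffun => [tuple of nseq (rbits A n) false]].
move: sum_le; rewrite sum_nat_const card_ffun card_bool card_ord.
have -> : 2 ^ 2 ^ a * (n.-1 * #|tape|) = (2 ^ 2 ^ a * n.-1) * #|tape| by rewrite mulnA.
have -> : n * (#|tape| * 2 ^ E) = (n * 2 ^ E) * #|tape| by lia.
rewrite leq_pmul2r // => le.
(* For [n > 1], [n] is at most [2 * n.-1]: the failure probability costs one extra bit. *)
have : 2 ^ 2 ^ a <= 2 ^ E.+1.
  rewrite expnS -(leq_pmul2r (_ : 0 < n.-1)); last by lia.
  by apply: leq_trans le _; rewrite mulnAC leq_mul2r; apply/orP; right; lia.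
by rewrite leq_exp2l // addn1.
Qed.

Lemma tree_lower c b (A : AlgoFor treeLCL) : 0 < c -> congest b A -> rand_solves c A ->
  exists k N, 0 < k /\ forall n, N <= n -> Nat.sqrt n <= k * rounds A n * (trunc_log 2 n) ^ 2.
Proof.
move=> c0 cA sA; pose k := 4 * (2 * Delta * (2 * b + 1) + 1).
exists k, 7; split=> [|n n7]; first by rewrite /k; lia.
set T := rounds A n; set l := trunc_log 2 n.
(* The largest [a] whose tree fits into [n] nodes; then [2 ^ a] exceeds a quarter of the square root
   of [n]. The threshold 7 makes [a] positive. *)
pose a := (trunc_log 2 n.+1).-1 %/ 2.
have L3 : 3 <= trunc_log 2 n.+1 by apply: trunc_log_max.
have a0 : 0 < a by rewrite divn_gt0 //; lia.
have /andP[lo hi] := lv_bounds (ltn0Sn n).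
have a2 : 2 * a + 1 <= trunc_log 2 n.+1 <= 2 * a + 2 by rewrite /a; lia.
have Qn : core_size a <= n.+1.
  by apply: leq_trans lo; rewrite leq_exp2l //; lia.
have l2 : 2 <= l by apply: trunc_log_max => //; lia.
have al : a + 1 <= 2 * l.
  have : 2 * a <= l; last by lia.
  apply: trunc_log_max => //.
  have : 2 ^ (2 * a).+1 <= n.+1 by [].
  have : 0 < 2 ^ (2 * a) by rewrite expn_gt0.
  by rewrite expnS; lia.
have sq : Nat.sqrt n < 4 * 2 ^ a.
  have h : n < 4 * 2 ^ a * (4 * 2 ^ a).
    have : n.+1 < 2 ^ (2 * a + 3).
      by apply: leq_trans (trunc_log_ltn _ (ltnSn 1)) _; rewrite leq_exp2l //; lia.
    by rewrite expnD mul2n -addnn expnD; lia.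
  apply/ltP/PeanoNat.Nat.sqrt_lt_square; apply/ltP; exact: h.
have p2 : 2 <= 2 ^ a by rewrite -{1}(expn1 2) leq_exp2l.
(* One factor [l] bounds the number of frontier nodes, the other the message length. The summand
   [1 + T] covers the case of at least [2 ^ a - 1] rounds. *)
have key : 2 ^ a <= T * l ^ 2 * (2 * Delta * (2 * b + 1)) + 1 + T.
  case: (ltnP T.+1 (2 ^ a)) => Ta; last by lia.
  apply: leq_trans (tree_lower_pow c0 cA sA a0 Qn Ta) _; rewrite -/T -/l.
  rewrite -addnA [1 + T]addnC addnA leq_add2r; apply: leq_trans (leq_addr _ _).
  have h : (b * l.+1).+1 <= l * (2 * b + 1) by nia.
  have -> : T * l ^ 2 * (2 * Delta * (2 * b + 1)) = T * (2 * l) * Delta * (l * (2 * b + 1)) by lia.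
  by apply: leq_mul => //; rewrite leq_mul2r leq_mul2l -addn1 al !orbT.
have T0 : 0 < T by move: key; case: (T) => //; rewrite !mul0n; lia.
(* With [T] positive, [1 + T] is at most [2 * T], which [T * l ^ 2] absorbs. *)
have l4 : 2 <= l ^ 2 by nia.
have key2 : 2 ^ a <= T * l ^ 2 * (2 * Delta * (2 * b + 1) + 1) by rewrite mulnDr; nia.
apply: leq_trans (ltnW sq) _; rewrite /k.
by rewrite (mulnAC _ T) -(mulnA 4) mulnAC; nia.
Qed.

Theorem theorem6p1 :
  exists P : LCL,
    (forall c, 0 < c ->
       exists A : AlgoFor P, det_solves c A /\
         exists K, forall n, rounds A n <= K * (trunc_log 2 n).+1) /\
    (forall c b, 0 < c -> forall A : AlgoFor P, congest b A -> rand_solves c A ->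
       exists k N, 0 < k /\
         forall n, N <= n -> Nat.sqrt n <= k * rounds A n * (trunc_log 2 n) ^ 2).
Proof.
exists treeLCL; split; first by move=> c _; exact: tree_upper.
by move=> c b c0 A cA sA; exact: tree_lower c0 cA sA.
Qed.
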